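(* Let $(\mathcal{M},\tau)$ be a finite von Neumann algebra with a faithful normal trace $\tau$. Suppose a von Neumann subalgebra $\mathcal{N}\subseteq\mathcal{M}$ and an element $Z\in\mathcal{M}$ satisfy the following conditions: (1) $Z\neq 0$ and $\tau(Z)=0$; (2) $Z$, $Z\big((\mathcal{N}'\cap\mathcal{M})\ominus\mathbb{C}1\big)$ and $\big((\mathcal{N}'\cap\mathcal{M})\ominus\mathbb{C}1\big)Z$ are mutually orthogonal in $L^2(\mathcal{M},\tau)$. Let $\mathfrak{A}\subseteq\mathcal{B}(L^2(\mathcal{M},\tau))$ be the algebra generated by $Z$, $\mathcal{N}$ and $\mathcal{M}'$. Then $\mathfrak{A}$ is a transitive algebra and is strongly dense in $\mathcal{B}(L^2(\mathcal{M},\tau))$.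
   Context: The trace $\tau$ is normalized, $\tau(1)=1$. $\mathcal{M}$ acts on $L^2(\mathcal{M},\tau)$ by left multiplication (GNS representation of $\tau$), and $\mathcal{M}'$ is its commutant in $\mathcal{B}(L^2(\mathcal{M},\tau))$; $\mathcal{M}$ is also viewed as a subset of $L^2(\mathcal{M},\tau)$. $\mathcal{N}'\cap\mathcal{M}$ is the relative commutant, and $(\mathcal{N}'\cap\mathcal{M})\ominus\mathbb{C}1=\{X\in\mathcal{N}'\cap\mathcal{M}:\tau(X)=0\}$. Condition (2) thus says $\tau(Z^*ZX)=\tau(Z^*XZ)=\tau((ZX)^*(YZ))=0$ for all trace-zero $X,Y\in\mathcal{N}'\cap\mathcal{M}$. ''Algebra generated'' means the (not necessarily self-adjoint or closed) algebra generated. A subalgebra of $\mathcal{B}(\mathcal{H})$ is transitive if it contains the identity and has no invariant closed subspaces other than $\{0\}$ and $\mathcal{H}$. ''Strongly dense'' means dense in the strong operator topology. *)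

(* Defs.v *)
From HB Require Import structures.
From mathcomp Require Import all_boot all_order all_algebra.
From mathcomp Require Import all_classical all_reals all_analysis.
From mathcomp.real_closed Require Import complex.

Set Implicit Arguments.
Unset Strict Implicit.
Unset Printing Implicit Defensive.

Import Order.TTheory GRing.Theory Num.Theory.
Import numFieldNormedType.Exports.

Local Open Scope classical_set_scope.
Local Open Scope ring_scope.
Local Open Scope complex_scope.

(* Complex Hilbert spaces.  The inner product of type {dot H for conjC} is
   linear in its first argument and conjugate-linear in the second one. *)
HB.mixin Record CompleteNormedModule_isHilbert (R : realType) H
    of CompleteNormedModule R[i] H := {
  hdot : {dot H for @Num.conj R[i]} ;
  hdot_norm : forall x : H, `|x| ^+ 2 = hdot x x
}.

#[short(type="hilbertType")]
HB.structure Definition Hilbert (R : realType) :=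
  {H of CompleteNormedModule R[i] H & CompleteNormedModule_isHilbert R H}.

Notation "''[' u , v ]" := (hdot u v) : ring_scope.

Section Operators.
Context {R : realType} {H : hilbertType R}.
Implicit Types (T S : H -> H) (A B M : set (H -> H)) (W : set H).

(* Operators are plain functions H -> H: the sum and the scaling are the
   pointwise ones, the product is \o and the unit is idfun. *)
Definition bounded_op : set (H -> H) := [set T | linear T /\ continuous T].

(* The adjoint of a bounded operator exists, by Riesz representation, and is
   unique; the default value 0 is never used on bounded operators. *)
Definition adj T : H -> H :=
  xget (0 : H -> H) [set S | forall u v, '[T u, v] = '[u, S v]].

Definition selfadjoint : set (H -> H) := [set T | bounded_op T /\ adj T = T].

(* The comparison in R[i] makes 0 <= z imply that z is real. *)
Definition op_le T S := forall u, '[T u, u] <= '[S u, u].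

Definition commutant A : set (H -> H) :=
  [set T | bounded_op T /\ forall S, A S -> T \o S = S \o T].

Definition von_neumann_algebra M :=
  (forall T, M T -> M (adj T)) /\ commutant (commutant M) = M.

(* Finite: every isometry is unitary, i.e. the unit is a finite projection. *)
Definition finite_algebra M :=
  forall V, M V -> adj V \o V = idfun -> V \o adj V = idfun.

Definition subalgebra A :=
  [/\ A `<=` bounded_op,
      A 0,
      forall T S, A T -> A S -> A (T + S),
      forall (c : R[i]) T, A T -> A (c *: T)
    & forall T S, A T -> A S -> A (T \o S)].

Definition generated_algebra A : set (H -> H) := smallest subalgebra A.

Definition closed_subspace W :=
  [/\ W 0,
      forall u v, W u -> W v -> W (u + v),
      forall (c : R[i]) u, W u -> W (c *: u)
    & closed W].

Definition transitive_algebra A :=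
  [/\ subalgebra A, A idfun &
    forall W, closed_subspace W -> (forall T, A T -> T @` W `<=` W) ->
      W = [set 0] \/ W = setT].

(* The strong operator topology is the one induced by {ptws H -> H}. *)
Definition strongly_dense A :=
  bounded_op `<=` closure (A : set {ptws H -> H}).

Definition orthogonal_sets (U V : set H) := forall u v, U u -> V v -> '[u, v] = 0.

Definition directed_ops (D : set (H -> H)) :=
  D !=set0 /\
  forall T S, D T -> D S -> exists2 Q, D Q & op_le T Q /\ op_le S Q.

Definition is_op_sup M (D : set (H -> H)) T :=
  [/\ (M `&` selfadjoint) T,
      forall S, D S -> op_le S T
    & forall Q, (M `&` selfadjoint) Q -> (forall S, D S -> op_le S Q) ->
        op_le T Q].

Record faithful_normal_trace M (tau : (H -> H) -> R[i]) : Prop := {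
  trace_linear : forall c T S, M T -> M S ->
    tau (c *: T + S) = c * tau T + tau S ;
  trace_positive : forall T, M T -> op_le 0 T -> 0 <= tau T ;
  trace_comm : forall T S, M T -> M S -> tau (T \o S) = tau (S \o T) ;
  trace_unit : tau idfun = 1 ;
  trace_faithful : forall T, M T -> tau (adj T \o T) = 0 -> T = 0 ;
  trace_normal : forall (D : set (H -> H)) T,
    D `<=` M `&` selfadjoint -> directed_ops D -> is_op_sup M D T ->
    supremums (tau @` D) (tau T)
}.

End Operators.

(* (L, iota, lambda) realizes L^2(M, tau): L is the completion of M, embedded
   by iota, for the inner product tau(y^* x), and lambda is the action of M by
   left multiplication.  L is determined by (M, tau) up to a unique unitary
   compatible with iota.  The values of iota and lambda off M are irrelevant. *)
Record is_L2 (R : realType) (H : hilbertType R) (M : set (H -> H))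
    (tau : (H -> H) -> R[i]) (L : hilbertType R)
    (iota : (H -> H) -> L) (lambda : (H -> H) -> (L -> L)) : Prop := {
  L2_linear : forall (c : R[i]) x y, M x -> M y ->
    iota (c *: x + y) = c *: iota x + iota y ;
  L2_dot : forall x y, M x -> M y -> '[iota x, iota y] = tau (adj y \o x) ;
  L2_dense : closure (iota @` M) = setT ;
  L2_bounded : forall x, M x -> bounded_op (lambda x) ;
  L2_left_mul : forall x y, M x -> M y -> lambda x (iota y) = iota (x \o y)
}.

(* Main.v *)
(* Let W be a closed subspace of L^n invariant under the algebra applied diagonally.
   Its orthogonal projection Q commutes with M' and with N, so Q = (x_ij) with x_ij in
   N' and M, and invariance under Z gives Z x_ij = sum_k x_ik Z x_kj.  Pairing with Z,
   the orthogonality relations leave |Z|^2 t_ij = |Z|^2 sum_k t_ik t_kj for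
   t_ij = tau (x_ij); hence T = (t_ij) is a projection, Q - T has Hilbert-Schmidt norm 0,
   and Q = T is a scalar matrix.  So W is stable under the diagonal action of every linear
   operator.  Applied to the closure of the orbit of n vectors this is strong density, and
   rank-one operators then give transitivity.

   That an operator on L = L^2(M, tau) commuting with M' is left multiplication by an element
   of M rests on the normality of tau: the bounded maps iota x |-> x h from L^2 to H
   separate L^2, the vectors h admitting one are dense in H, and an element of the
   bicommutant of M on L^2 is transported to H along these intertwiners. *)
Require Import Defs.
From HB Require Import structures.
From mathcomp Require Import all_boot all_order all_algebra.
From mathcomp Require Import all_classical all_reals all_analysis.
From mathcomp.real_closed Require Import complex.
From mathcomp Require Import ring lra.

Set Implicit Arguments.
Unset Strict Implicit.
Unset Printing Implicit Defensive.

Import Order.TTheory GRing.Theory Num.Theory.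
Import numFieldNormedType.Exports.

Local Open Scope classical_set_scope.
Local Open Scope ring_scope.
Local Open Scope complex_scope.

Local Notation Re := complex.Re.

(** * Hilbert spaces *)

(** The adjoint of [Z] need not be among the generators, so invariance gives only Z Q = Q Z Q, and Q
    is not known to commute with Z. The pairing works around this: since adj (x_ik) = x_ki, <x_ik Z
    x_kj, Z> = <Z x_kj, x_ki Z>, and after splitting x_ij = t_ij + X_ij with tau (X_ij) = 0 every
    cross term vanishes by one of the orthogonality relations. The Hilbert-Schmidt norm is computed
    by columns: the sum over i of |X_ij|^2 is that of |x_ij|^2 minus that of |t_ij|^2, and both
    equal t_jj. The analytic obstacle is that M is its own bicommutant on H, while the commutant in
    the algebra is taken on L^2. The two spaces are compared through the trace and the vector
    functionals <d h, h>. Domination of one functional by another is localized below a positive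
    element r; the elements r adj (x) x r lie below multiples of r, and the functionals take on them
    the values |x r|^2 in L^2 and |x (r h)|^2 in H. *)

Section Complex.
Context {R : realType}.
Implicit Types (a b : R) (x y z : R[i]).

Lemma ReD x y : Re (x + y) = Re x + Re y.
Proof. by case: x y => [? ?] [? ?]. Qed.

Lemma ReN x : Re (- x) = - Re x.
Proof. by case: x. Qed.

Lemma ReM_real a x : Re (a%:C * x) = a * Re x.
Proof. by case: x => ? ?; rewrite /= mul0r subr0. Qed.

Lemma Re_conj x : Re (x^* )%R = Re x.
Proof. by case: x. Qed.

(** Upgrades arguments that control only real parts, such as the minimization of a real functional:
    the imaginary part of [x] is minus the real part of ['i * x]. *)
Lemma complex_eq x y : Re x = Re y -> Re ('i * x) = Re ('i * y) -> x = y.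
Proof.
case: x y => [a b] [c d] /= ->; rewrite !mul0r !mul1r !sub0r.
by move/oppr_inj ->.
Qed.

Lemma ge0_complex x : 0 <= x -> x = (Re x)%:C.
Proof. by case: x => a b; rewrite lecE /= => /andP[/eqP -> _]. Qed.

Lemma conj_real a : (a%:C^* )%R = a%:C.
Proof. by rewrite conj_Creal // complex_real. Qed.

End Complex.

(** * Orthogonal projection and Riesz representation for abstract positive forms *)

Section PreHilbert.
Context {R : realType} {V : lmodType R[i]} (d : V -> V -> R[i]).
Hypothesis dlin : forall a x y z, d (a *: x + y) z = a * d x z + d y z.
Hypothesis dconj : forall x y, d y x = (d x y)^*%R.
Hypothesis dpos : forall x, 0 <= d x x.

Let rd x y := Re (d x y).

Let dDl x y z : d (x + y) z = d x z + d y z.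
Proof. by rewrite -[x]scale1r dlin scale1r mul1r. Qed.

Let d0l z : d 0 z = 0.
Proof. by apply: (addrI (d 0 z)); rewrite -dDl !addr0. Qed.

Let dZl a x z : d (a *: x) z = a * d x z.
Proof. by rewrite -[a *: x]addr0 dlin d0l addr0. Qed.

Let rdC x y : rd x y = rd y x.
Proof. by rewrite /rd dconj Re_conj. Qed.

Let rdD x y z : rd (x + y) z = rd x z + rd y z.
Proof. by rewrite /rd dDl ReD. Qed.

Let rdZ (t : R) x z : rd (t%:C *: x) z = t * rd x z.
Proof. by rewrite /rd dZl ReM_real. Qed.

Let rd_ge0 x : 0 <= rd x x.
Proof. by have := dpos x; rewrite lecE => /andP[]. Qed.

(** Completeness is stated with sequences and the squared norm of the form, so that [V] carries no
    topology: the results serve a Hilbert space and the functions from a finite type into one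
    alike. *)
Definition complete_set (W : set V) := forall u : nat -> V, (forall n, W (u n)) ->
  (forall e : R, 0 < e -> exists N, forall m n, (N <= m)%N -> (N <= n)%N ->
    Re (d (u m - u n) (u m - u n)) < e) ->
  exists2 w, W w & forall e : R, 0 < e -> exists N, forall n, (N <= n)%N ->
    Re (d (u n - w) (u n - w)) < e.

Let q x := rd x x.

Let rdDr x y z : rd z (x + y) = rd z x + rd z y.
Proof. by rewrite rdC rdD !(rdC z). Qed.

Let rdZr (t : R) x z : rd z (t%:C *: x) = t * rd z x.
Proof. by rewrite rdC rdZ rdC. Qed.

Let qD x y : q (x + y) = q x + 2 * rd x y + q y.
Proof. by rewrite /q rdD !rdDr (rdC y x); ring. Qed.

Let qZ (t : R) x : q (t%:C *: x) = t ^+ 2 * q x.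
Proof. by rewrite /q rdZ rdZr mulrA expr2. Qed.

Let rdN x z : rd (- x) z = - rd x z.
Proof.
have -> : - x = (-1)%:C *: x by rewrite rmorphN1 scaleN1r.
by rewrite rdZ mulN1r.
Qed.

Let rdB x y z : rd (x - y) z = rd x z - rd y z.
Proof. by rewrite rdD rdN. Qed.

(** Nonnegativity of the polynomial t |-> q (x + t y) at its minimum. Degenerate forms are covered,
    since the inequality is also applied to <c x, y> for a positive operator [c]. *)
Lemma dCS x y : (Re (d x y)) ^+ 2 <= Re (d x x) * Re (d y y).
Proof.
change (rd x y ^+ 2 <= q x * q y).
have key (t : R) : 0 <= q x + 2 * t * rd x y + t ^+ 2 * q y.
  have := rd_ge0 (x + t%:C *: y); rewrite -/(q _) qD qZ rdZr; lra.
have [qx qy] : 0 <= q x /\ 0 <= q y by split; exact: rd_ge0.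
have [y0|y0] := eqVneq (q y) 0.
  rewrite y0 mulr0; rewrite y0 in key.
  have [->|r0] := eqVneq (rd x y) 0; first by rewrite expr0n.
  (* With q y = 0 the polynomial is affine, and at this [t] it would equal -1. *)
  have := key (- (q x + 1) / (2 * rd x y)); rewrite mulr0 addr0.
  have -> : 2 * (- (q x + 1) / (2 * rd x y)) * rd x y = - (q x + 1) by field.
  by lra.
have {}y0 : 0 < q y by rewrite lt_def y0.
have := key (- rd x y / q y).
have -> : q x + 2 * (- rd x y / q y) * rd x y + (- rd x y / q y) ^+ 2 * q y =
  (q x * q y - rd x y ^+ 2) / q y by field; apply: lt0r_neq0.
by rewrite pmulr_lge0 ?invr_gt0 // subr_ge0.
Qed.

(* Both the orthogonal projection onto W (f := d ^~ v) and, for complete V, the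
   Riesz representation theorem (W := setT).  The representing vector minimizes
   |x|^2 - 2 Re f(x) over W. *)
Lemma riesz_subspace (W : set V) (f : V -> R[i]) (C : R) :
  W 0 -> (forall a x y, W x -> W y -> W (a *: x + y)) -> complete_set W ->
  (forall a x y, W x -> W y -> f (a *: x + y) = a * f x + f y) ->
  (forall x, W x -> (Re (f x)) ^+ 2 <= C * Re (d x x)) ->
  exists2 w, W w & forall x, W x -> f x = d x w.
Proof.
move=> W0 Wlin Wc flin fb.
have WD x y : W x -> W y -> W (x + y).
  by move=> Wx Wy; rewrite -[x]scale1r; exact: Wlin.
have WZ a x : W x -> W (a *: x) by move=> Wx; rewrite -[_ *: _]addr0; exact: Wlin.
have f0 : f 0 = 0 by apply: (addrI (f 0)); rewrite -{1}[f 0]mul1r -flin // scale1r !addr0.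
have fD x y : W x -> W y -> f (x + y) = f x + f y.
  by move=> Wx Wy; rewrite -[x]scale1r flin // scale1r mul1r.
have fZ a x : W x -> f (a *: x) = a * f x.
  by move=> Wx; rewrite -[a *: x]addr0 flin // f0 addr0.
wlog C0 : C fb / 0 <= C.
  move=> /(_ `|C|); apply => // x Wx; apply: le_trans (fb _ Wx) _.
  by apply: ler_wpM2r; [exact: rd_ge0 | exact: ler_norm].
pose J x := q x - 2 * Re (f x).
have Jlb x : W x -> - C <= J x.
  move=> Wx; have := fb _ Wx; rewrite -/(rd x x) -/(q x) /J.
  have : 0 <= q x by exact: rd_ge0.
  have : 0 <= (q x - C) ^+ 2 by exact: sqr_ge0.
  move: (q x) (Re (f x)) => a r; nra.
have hJ : has_inf (J @` W).
  split; first by exists (J 0), 0.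
  by exists (- C) => _ [x Wx <-]; exact: Jlb.
set D := inf (J @` W).
have DJ x : W x -> D <= J x by move=> Wx; apply: ge_inf; [exact: hJ.2 | exists x].
have /choice [u uP] (n : nat) : exists u, W u /\ J u < D + n.+1%:R^-1.
  have [|_ [x Wx <-] xlt] := @inf_adherent _ _ (n.+1%:R^-1 : R) _ hJ.
    by rewrite invr_gt0 ltr0n.
  by exists x.
have Wu n : W (u n) by have [] := uP n.
have inv_small (e : R) : 0 < e -> exists N, forall n, (N <= n)%N -> n.+1%:R^-1 < e.
  move=> e0; have [N _ /= HN] := near_infty_natSinv_lt (PosNum e0).
  by exists N => n Nn; exact: HN.
(* Parallelogram law: [J] is at least [D] at the midpoint of [x] and [y]. Hence minimizing sequences
   are Cauchy. *)
have JB x y : W x -> W y -> q (x - y) <= 2 * (J x - D) + 2 * (J y - D).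
  move=> Wx Wy; have := DJ _ (WZ (2^-1)%:C _ (WD _ _ Wx Wy)).
  rewrite /J fZ ?fD //; last exact: WD.
  rewrite qZ ReM_real ReD -[x - y]/(x + - y) !qD.
  rewrite (rdC x (- y)) rdN (rdC y x).
  have -> : q (- y) = q y by rewrite /q rdN rdC rdN opprK.
  by lra.
have [||w Ww wlim] := Wc u => //.
  move=> e e0; have e4 : 0 < e / 4 by lra.
  have [N HN] := inv_small _ e4.
  exists N => m n /HN Hm /HN Hn; change (q (u m - u n) < e).
  have := JB _ _ (Wu m) (Wu n).
  have [_] := uP m; have [_] := uP n; move: Hm Hn.
  by move: (m.+1%:R^-1) (n.+1%:R^-1) => a b; lra.
exists w => // x Wx.
have main y : W y -> Re (f y) = rd w y.
  move=> Wy.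
  have qy : 0 <= q y by exact: rd_ge0.
  have s0 : q y + 1 != 0 by apply: lt0r_neq0; lra.
  (* First variation: [J (u n)] is within 1/(n+1) of the infimum, so moving [u n] along [y] by the
     nearly optimal [t] bounds the derivative [A]. The denominator q y + 1 instead of q y avoids a
     division by zero. *)
  have crit n : (rd (u n) y - Re (f y)) ^+ 2 <= n.+1%:R^-1 * (q y + 1).
    have [_ Jn] := uP n.
    set A := rd _ _ - _; pose t := - A / (q y + 1).
    have := DJ _ (WD _ _ (Wu n) (WZ t%:C _ Wy)).
    rewrite /J fD ?fZ //; last exact: WZ.
    rewrite ReD ReM_real qD qZ rdZr.
    have tE : t * (q y + 1) = - A by rewrite /t; field.
    have -> : rd (u n) y = A + Re (f y) by rewrite subrK.
    move: Jn; rewrite /J.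
    have -> : A = - (t * (q y + 1)) by rewrite tE opprK.
    set i := n.+1%:R^-1; move=> Jn le.
    have {le Jn} ti : t ^+ 2 * (q y + 1) <= i by have := sqr_ge0 t; lra.
    have -> : (- (t * (q y + 1))) ^+ 2 = (t ^+ 2 * (q y + 1)) * (q y + 1) by ring.
    by apply: ler_wpM2r => //; lra.
  apply/eqP; rewrite -subr_eq0 -sqrf_eq0; apply/eqP/le_anti; rewrite sqr_ge0 andbT.
  apply/ler_addgt0Pl => e e0; rewrite addr0.
  pose e1 := e / (4 * (q y + 1)).
  have e10 : 0 < e1 by rewrite divr_gt0 //; lra.
  have [N1 H1] := inv_small _ e10; have [N2 H2] := wlim _ e10.
  pose n := maxn N1 N2.
  have := H1 n (leq_maxl _ _); have := H2 n (leq_maxr _ _).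
  rewrite -/(rd _ _) -/(q _) => h2 h1.
  have e1E : e = 4 * (e1 * (q y + 1)) by rewrite /e1; field.
  have := dCS (u n - w) y; rewrite -!/(rd _ _) -/(q y) -/(q (u n - w)) rdB.
  have := crit n; move: h1 h2.
  move: (q (u n - w)) (n.+1%:R^-1) (rd_ge0 (u n - w)) => a b.
  move: (rd (u n) y) (rd w y) (Re (f y)) => r s t _ h1 h2 h3 h4.
  have h5 : b * (q y + 1) <= e1 * (q y + 1) by apply: ler_wpM2r; lra.
  have h6 : a * q y <= e1 * (q y + 1) by nra.
  by have := sqr_ge0 (r - t + (r - s)); rewrite e1E; nra.
have hx := main _ Wx; have hix := main _ (WZ 'i _ Wx).
apply: complex_eq; first by rewrite hx rdC.
by rewrite -(fZ _ _ Wx) hix rdC /rd dZl.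
Qed.

Hypothesis ddef : forall x, Re (d x x) = 0 -> x = 0.

Let dB x y z : d (x - y) z = d x z - d y z.
Proof. by rewrite addrC -scaleN1r dlin mulN1r addrC. Qed.

(** Uniqueness of the point of [W] with residue orthogonal to [W] yields both the linearity of [P]
    and P = id on [W]. *)
Lemma projection_exists (W : set V) :
  W 0 -> (forall a x y, W x -> W y -> W (a *: x + y)) -> complete_set W ->
  exists P : V -> V, [/\ linear P, forall x, W (P x),
    forall x w, W w -> d (x - P x) w = 0, forall x y, d (P x) y = d x (P y) &
    forall x, W x -> P x = x].
Proof.
move=> W0 Wlin Wc.
have /choice [P PP] u : exists w, W w /\ forall x, W x -> d x u = d x w.
  have [||w Ww h] := @riesz_subspace W (d ^~ u) (Re (d u u)) W0 Wlin Wc.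
  - by move=> a x y _ _; rewrite dlin.
  - by move=> x _; rewrite mulrC dCS.
  by exists w.
have WB x y : W x -> W y -> W (x - y).
  by move=> Wx Wy; rewrite addrC -scaleN1r; exact: Wlin.
have WP u : W (P u) by have [] := PP u.
have orth x w : W w -> d (x - P x) w = 0.
  move=> Ww; have [_ /(_ _ Ww) h] := PP x.
  by rewrite dB !(dconj w) h subrr.
have uniq x y : W y -> (forall w, W w -> d (x - y) w = 0) -> P x = y.
  move=> Wy h; apply/eqP; rewrite -subr_eq0; apply/eqP; apply: ddef.
  have W1 : W (P x - y) by apply: WB.
  have := h _ W1; rewrite -[x - y](subrKA (P x)) dDl (orth _ _ W1) add0r.
  by move=> ->.
exists P; split => //.
- move=> a x y; apply: uniq; first exact: Wlin.
  move=> w Ww; have -> : a *: x + y - (a *: P x + P y) = a *: (x - P x) + (y - P y).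
    by rewrite scalerBr opprD addrACA.
  by rewrite dlin !orth // mulr0 addr0.
- move=> x y; have [_ /(_ _ (WP x)) ->] := PP y.
  rewrite (dconj _ (P x)) (dconj _ x); congr (_ ^*)%R.
  by have [_ /(_ _ (WP y)) ->] := PP x.
by move=> x Wx; apply: uniq => // w _; rewrite subrr d0l.
Qed.

Lemma projection_le (x y : V) : d (x - y) y = 0 -> Re (d y y) <= Re (d x x).
Proof.
move=> h; have := qD (x - y) y; have -> : rd (x - y) y = 0 by rewrite /rd h.
rewrite subrK mulr0 addr0 => e; change (q y <= q x); rewrite e.
by rewrite lerDr rd_ge0.
Qed.

(** The difference P (T x) - T (P x) lies in [W]. It equals T (x - P x) minus the residue of T x,
    and both are orthogonal to [W], the former because [T'] preserves [W]. *)
Lemma projection_comm (W : set V) (P T T' : V -> V) :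
  (forall x, W (P x)) -> (forall x w, W w -> d (x - P x) w = 0) ->
  (forall x y, T (x - y) = T x - T y) -> (forall x y, d (T x) y = d x (T' y)) ->
  (forall x, W x -> W (T x)) -> (forall x, W x -> W (T' x)) ->
  (forall x y, W x -> W y -> W (x - y)) -> forall x, P (T x) = T (P x).
Proof.
move=> WP orth TB TT' WT WT' WB x; apply/eqP; rewrite -subr_eq0; apply/eqP.
apply: ddef; set w := _ - _; have Ww : W w by apply: WB => //; exact: WT.
have -> : d w w = d (T (x - P x)) w - d (T x - P (T x)) w.
  by rewrite -dB TB; congr d; rewrite opprB addrC addrA subrK.
by rewrite orth // TT' orth ?subr0 //; exact: WT'.
Qed.

End PreHilbert.

(** * Real-valued norm, closure and completeness in a Hilbert space *)

Section HilbertNorm.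
Context {R : realType} {H : hilbertType R}.
Implicit Types (x y z : H) (a : R[i]).

(** The norm takes values in [R[i]]; its real part makes estimates accessible to reasoning in the
    ordered field [R]. *)
Definition nm x : R := Re `|x|.

Lemma nmE x : `|x| = (nm x)%:C.
Proof. by apply: ge0_complex. Qed.

Lemma dot_linear a x y z : '[a *: x + y, z] = a * '[x, z] + '[y, z].
Proof. by rewrite linearDl linearZl_LR. Qed.

Lemma dotC x y : '[y, x] = ('[x, y]^* )%R.
Proof. by rewrite hermC /= expr0 mul1r. Qed.

Lemma dot_ge0 x : 0 <= '[x, x].
Proof. by rewrite -hdot_norm exprn_ge0. Qed.

Lemma dotE x : '[x, x] = (nm x ^+ 2)%:C.
Proof. by rewrite -hdot_norm nmE rmorphXn. Qed.

Lemma nm2E x : Re '[x, x] = nm x ^+ 2.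
Proof. by rewrite dotE. Qed.

Lemma nm_ge0 x : 0 <= nm x.
Proof. by have := normr_ge0 x; rewrite nmE ler0c. Qed.

Lemma nm0 : nm (0 : H) = 0.
Proof. by rewrite /nm normr0. Qed.

Lemma nm_eq0 x : nm x = 0 -> x = 0.
Proof. by move=> h; apply/eqP; rewrite -normr_eq0 nmE h. Qed.

Lemma dot_def x : Re '[x, x] = 0 -> x = 0.
Proof. by rewrite nm2E => /eqP; rewrite sqrf_eq0 => /eqP /nm_eq0. Qed.

Lemma nmD x y : nm (x + y) <= nm x + nm y.
Proof. by have := ler_normD x y; rewrite !nmE -rmorphD lecR. Qed.

Lemma nmN x : nm (- x) = nm x.
Proof. by rewrite /nm normrN. Qed.

Lemma nmBC x y : nm (x - y) = nm (y - x).
Proof. by rewrite -nmN opprB. Qed.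

Lemma nmB x y : nm (x - y) <= nm x + nm y.
Proof. by rewrite -(nmN y) nmD. Qed.

Lemma nmZ a x : nm (a *: x) = Re `|a| * nm x.
Proof. by rewrite /nm normrZ (ge0_complex (normr_ge0 a)) ReM_real. Qed.

Lemma Re_dot_le x y : `|Re '[x, y]| <= nm x * nm y.
Proof.
rewrite -ler_sqr ?nnegrE ?mulr_ge0 ?nm_ge0 // real_normK ?num_real // exprMn -!nm2E.
exact: (@dCS _ _ (fun x y => '[x, y]) dot_linear dotC dot_ge0).
Qed.

Lemma dot_eq x y : (forall z, '[z, x] = '[z, y]) -> x = y.
Proof.
move=> h; apply/eqP; rewrite -subr_eq0; apply/eqP/dot_def.
by rewrite linearBr /= h subrr.
Qed.

Lemma dot_eql x y : (forall z, '[x, z] = '[y, z]) -> x = y.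
Proof. by move=> h; apply: dot_eq => z; rewrite !(dotC _ z) h. Qed.

Lemma closure_nm (A : set H) x :
  closure A x <-> forall e : R, 0 < e -> exists2 y, A y & nm (x - y) < e.
Proof.
split=> [cl e e0|h].
  have /cl [y [Ay]] : nbhs x (ball x (e%:C)) by apply: nbhsx_ballx; rewrite ltcR.
  by rewrite -ball_normE /= nmE ltcR => xy; exists y.
move=> B /nbhs_ballP [e /= e0 eB].
have eE : e = (Re e)%:C by apply: ge0_complex; exact: ltW.
have [|y Ay xy] := h (Re e); first by rewrite -ltcR -eE.
by exists y; split=> //; apply: eB; rewrite -ball_normE /= nmE eE ltcR.
Qed.

Lemma closed_nm (A : set H) x : closed A ->
  (forall e : R, 0 < e -> exists2 y, A y & nm (x - y) < e) -> A x.
Proof. by move=> cA h; apply: cA; apply/closure_nm. Qed.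

Lemma hilbert_complete (u : nat -> H) :
  (forall e : R, 0 < e -> exists N, forall m n, (N <= m)%N -> (N <= n)%N ->
    nm (u m - u n) < e) ->
  exists w, forall e : R, 0 < e -> exists N, forall n, (N <= n)%N -> nm (u n - w) < e.
Proof.
move=> uc; have : cvg (u @ \oo).
  apply/cauchy_cvgP; apply: cauchy_exP => e e0.
  have eE : e = (Re e)%:C by apply: ge0_complex; exact: ltW.
  have [|N HN] := uc (Re e); first by rewrite -ltcR -eE.
  exists (u N), N => //= n Nn; rewrite -ball_normE /= nmE eE ltcR.
  exact: HN.
move=> cu; exists (lim (u @ \oo)) => e e0.
have /cvgrPdist_lt /(_ e%:C) := cu; rewrite ltcR => /(_ e0) [N _ HN].
by exists N => n /HN /=; rewrite nmE ltcR nmBC.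
Qed.

Lemma closed_complete (A : set H) : closed A ->
  complete_set (fun x y => '[x, y]) A.
Proof.
move=> cA u Au uc.
have [|w wP] := @hilbert_complete u.
  move=> e e0; have [|N HN] := uc (e ^+ 2); first by rewrite exprn_gt0.
  exists N => m n Nm Nn; have := HN _ _ Nm Nn.
  by rewrite nm2E ltr_pXn2r // nnegrE ?nm_ge0 // ltW.
exists w.
  apply: closed_nm => // e /wP [N HN]; exists (u N) => //.
  by rewrite nmBC; exact: HN.
move=> e e0; have [|N HN] := wP (Num.sqrt e); first by rewrite sqrtr_gt0.
exists N => n /HN; rewrite nm2E -{2}(sqr_sqrtr (ltW e0)).
by move=> h; rewrite ltr_pXn2r // nnegrE ?nm_ge0 // sqrtr_ge0.
Qed.

End HilbertNorm.

(** * Bounded linear maps and their extension by density *)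

Section BoundedLinear.
Context {R : realType}.
Implicit Types (E F G : hilbertType R).

(** An explicit constant in place of continuity; source and target may differ, as they do for the
    maps from L^2 to H. *)
Definition blin {E F} (T : E -> F) :=
  linear T /\ exists C : R, forall x, nm (T x) <= C * nm x.

Lemma bounded_opE {E} : @bounded_op R E = blin.
Proof.
apply/funext => T; apply/propext; split=> -[lT bT]; split=> //.
  pose T' : {linear E -> E} := HB.pack T (GRing.isLinear.Build _ _ _ _ T lT).
  have /linear_boundedP := @continuous_linear_bounded _ _ _ 0 T' (bT 0).
  move=> /pinfty_ex_gt0 [r r0 hr]; exists (Re r) => x.
  by have := hr x; rewrite /= !nmE (ge0_complex (ltW r0)) -rmorphM lecR.
pose T' : {linear E -> E} := HB.pack T (GRing.isLinear.Build _ _ _ _ T lT).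
have [C hC] := bT.
apply: (@bounded_linear_continuous _ _ _ T'); apply/linear_boundedP.
exists C%:C; split; first by rewrite complex_real.
move=> r Cr x; rewrite !nmE; apply: le_trans (_ : (C * nm x)%:C <= _).
  by rewrite lecR.
by rewrite rmorphM; apply: ler_wpM2r; [rewrite ler0c nm_ge0 | exact: ltW].
Qed.

Lemma linD {V W : lmodType R[i]} (T : V -> W) x y : linear T -> T (x + y) = T x + T y.
Proof. by move=> lT; rewrite -[x]scale1r lT !scale1r. Qed.

Lemma lin0 {V W : lmodType R[i]} (T : V -> W) : linear T -> T 0 = 0.
Proof. by move=> lT; apply: (addrI (T 0)); rewrite -linD // !addr0. Qed.

Lemma linZ {V W : lmodType R[i]} (T : V -> W) a x : linear T -> T (a *: x) = a *: T x.
Proof. by move=> lT; rewrite -[a *: x]addr0 lT lin0 // addr0. Qed.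

Lemma linB {V W : lmodType R[i]} (T : V -> W) x y : linear T -> T (x - y) = T x - T y.
Proof. by move=> lT; rewrite linD // -[in T (- y)]scaleN1r linZ // scaleN1r. Qed.

Lemma blin_lin {E F} (T : E -> F) : blin T -> linear T.
Proof. by case. Qed.

Lemma blin_bound {E F} (T : E -> F) : blin T ->
  exists2 C : R, 0 < C & forall x, nm (T x) <= C * nm x.
Proof.
move=> [_ [C hC]]; exists (`|C| + 1) => [|x]; first by rewrite ltr_wpDl.
apply: le_trans (hC x) _; apply: ler_wpM2r; first exact: nm_ge0.
by apply: le_trans (ler_norm _) _; rewrite lerDl.
Qed.

Lemma blin_comp {E F G} (S : F -> G) (T : E -> F) : blin S -> blin T -> blin (S \o T).
Proof.
move=> bS bT; have [C C0 hC] := blin_bound bS; have [D D0 hD] := blin_bound bT.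
split=> [a x y|]; first by rewrite /= (blin_lin bT) (blin_lin bS).
exists (C * D) => x; apply: le_trans (hC _) _.
by rewrite -mulrA ler_wpM2l // ltW.
Qed.

Lemma blin_id {E} : blin (idfun : E -> E).
Proof. by split=> //; exists 1 => x; rewrite mul1r. Qed.

Lemma blin0 {E F} : blin (0 : E -> F).
Proof.
split=> [a x y|]; first by rewrite scaler0 addr0.
by exists 0 => x; rewrite nm0 mul0r.
Qed.

Lemma blin_linear {E F} a (S T : E -> F) : blin S -> blin T -> blin (a *: S + T).
Proof.
move=> bS bT; have [C C0 hC] := blin_bound bS; have [D D0 hD] := blin_bound bT.
split=> [b x y|].
  rewrite !fctE (blin_lin bS) (blin_lin bT).
  by rewrite !scalerDr !scalerA (mulrC b) addrACA.
exists (Re `|a| * C + D) => x; rewrite !fctE; apply: le_trans (nmD _ _) _.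
rewrite mulrDl; apply: lerD => //; rewrite nmZ -mulrA ler_wpM2l //.
by have := normr_ge0 a; rewrite lecE => /andP[].
Qed.

Lemma blinD {E F} (S T : E -> F) : blin S -> blin T -> blin (S + T).
Proof. by move=> bS bT; rewrite -[S]scale1r; exact: blin_linear. Qed.

Lemma blinZ {E F} a (S : E -> F) : blin S -> blin (a *: S).
Proof. by move=> bS; rewrite -[_ *: _]addr0; apply: blin_linear => //; exact: blin0. Qed.

Lemma blinB {E F} (S T : E -> F) : blin S -> blin T -> blin (S - T).
Proof. by move=> bS bT; rewrite addrC -scaleN1r; exact: blin_linear. Qed.

Definition dense_nm {E} (D : set E) :=
  forall x (e : R), 0 < e -> exists2 y, D y & nm (x - y) < e.

Lemma dense_le {E F G} (A : E -> F) (B : E -> G) (C : R) (D : set E) :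
  blin A -> blin B -> 0 <= C -> dense_nm D ->
  (forall x, D x -> nm (A x) <= C * nm (B x)) -> forall x, nm (A x) <= C * nm (B x).
Proof.
move=> bA bB C0 dD hD x; apply/ler_addgt0Pr => e e0.
have [a a0 ha] := blin_bound bA; have [b b0 hb] := blin_bound bB.
have K0 : 0 < a + C * b by apply: ltr_wpDr => //; rewrite mulr_ge0 // ltW.
have [|y Dy xy] := dD x (e / (a + C * b)); first by rewrite divr_gt0.
have hAx : nm (A x) <= nm (A y) + a * nm (x - y).
  have -> : A x = A y + A (x - y) by rewrite (linB _ _ (blin_lin bA)) addrC subrK.
  by apply: le_trans (nmD _ _) _; rewrite lerD2l.
have hBy : nm (B y) <= nm (B x) + b * nm (x - y).
  have -> : B y = B x - B (x - y) by rewrite (linB _ _ (blin_lin bB)) opprB addrC subrK.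
  by apply: le_trans (nmB _ _) _; rewrite lerD2l.
have h : (a + C * b) * nm (x - y) <= e.
  by rewrite mulrC -ler_pdivlMr // ltW.
have := hD _ Dy; have : C * nm (B y) <= C * (nm (B x) + b * nm (x - y)).
  exact: ler_wpM2l.
lra.
Qed.

Lemma dense_eq {E F} (A B : E -> F) (D : set E) :
  blin A -> blin B -> dense_nm D -> (forall x, D x -> A x = B x) -> A = B.
Proof.
move=> bA bB dD h; apply/funext => x; apply/eqP; rewrite -subr_eq0; apply/eqP.
apply: nm_eq0; apply/le_anti; rewrite nm_ge0 andbT.
have := @dense_le _ _ _ (A - B) (A - B) 0 D (blinB bA bB) (blinB bA bB) (lexx _) dD.
move=> /(_ _ x); rewrite mul0r; apply => y Dy.
by rewrite mul0r !fctE h // subrr nm0.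
Qed.

Lemma adjoint_exists {E F} (T : E -> F) : blin T ->
  exists2 S : F -> E, blin S & forall x y, '[T x, y] = '[x, S y].
Proof.
move=> bT; have [C C0 hC] := blin_bound bT.
have cE : complete_set (fun x y : E => '[x, y]) setT.
  by apply: closed_complete; exact: closedT.
have /choice [S hS] (y : F) : exists w : E, forall x, '[T x, y] = '[x, w].
  have [||w _ h] := @riesz_subspace _ _ _ (@dot_linear _ E) (@dotC _ E) (@dot_ge0 _ E)
    setT (fun x => '[T x, y]) ((C * nm y) ^+ 2) I (fun _ _ _ _ _ => I) cE.
  - by move=> a x z _ _; rewrite (blin_lin bT) dot_linear.
  - move=> x _; rewrite nm2E -exprMn -(real_normK (num_real _)).
    rewrite lerXn2r ?nnegrE ?mulr_ge0 ?nm_ge0 ?(ltW C0) //.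
    apply: le_trans (Re_dot_le _ _) _.
    by rewrite mulrAC ler_wpM2r ?nm_ge0.
  by exists w => x; exact: h.
exists S => //; split.
  move=> a y z; apply: dot_eq => x.
  by rewrite -hS !(dotC (_ + _)) !dot_linear !rmorphD !rmorphM /= -!dotC !hS.
exists C => y; have [y0|y0] := eqVneq (nm (S y)) 0.
  by rewrite y0 mulr_ge0 ?nm_ge0 // ltW.
have y1 : 0 < nm (S y) by rewrite lt_def y0 nm_ge0.
rewrite -(ler_pM2l y1) -expr2 -nm2E -hS.
apply: le_trans (ler_norm _) _; apply: le_trans (Re_dot_le _ _) _.
by rewrite mulrCA mulrA ler_wpM2r ?nm_ge0.
Qed.

(** The map is given by its graph because its values come from representatives, as in iota x |-> x
    h. The bound makes the graph single-valued, and [T] is its closure. *)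
Lemma extension {E F} (G : E -> F -> Prop) (C : R) : 0 <= C ->
  (forall a x y u v, G x u -> G y v -> G (a *: x + y) (a *: u + v)) ->
  (forall x u, G x u -> nm u <= C * nm x) ->
  (forall x (e : R), 0 < e -> exists y u, G y u /\ nm (x - y) < e) ->
  exists2 T : E -> F, blin T & forall x u, G x u -> T x = u.
Proof.
move=> C0 Glin Gb Gd.
pose cl x w := forall e : R, 0 < e -> exists y u, [/\ G y u, nm (x - y) < e & nm (w - u) < e].
have clG x u : G x u -> cl x u.
  by move=> Gxu e e0; exists x, u; split; rewrite ?subrr ?nm0.
have cllin a x y u v : cl x u -> cl y v -> cl (a *: x + y) (a *: u + v).
  move=> hx hy e e0; pose K := Re `|a| + 1.
  have a0 : 0 <= Re `|a| by have := normr_ge0 a; rewrite lecE => /andP[].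
  have K0 : 0 < K by rewrite /K; lra.
  have eK : 0 < e / K by rewrite divr_gt0.
  have [x' [u' [Gx hx' hu']]] := hx _ eK; have [y' [v' [Gy hy' hv']]] := hy _ eK.
  have KE : e = Re `|a| * (e / K) + e / K.
    by rewrite -{2}[e / K]mul1r -mulrDl -/K mulrC divfK // lt0r_neq0.
  exists (a *: x' + y'), (a *: u' + v'); split; first exact: Glin.
    rewrite opprD addrACA -scalerBr; apply: le_lt_trans (nmD _ _) _.
    by rewrite nmZ KE; apply: ler_ltD => //; rewrite ler_wpM2l // ltW.
  rewrite opprD addrACA -scalerBr; apply: le_lt_trans (nmD _ _) _.
  by rewrite nmZ KE; apply: ler_ltD => //; rewrite ler_wpM2l // ltW.
have clb x w : cl x w -> nm w <= C * nm x.
  move=> h; apply/ler_addgt0Pr => e e0.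
  have e1 : 0 < e / (C + 1) by rewrite divr_gt0 //; lra.
  have [y [u [/Gb hu hy hw]]] := h _ e1.
  have h1 : nm w <= nm (w - u) + nm u by rewrite -{1}[w](subrK u) nmD.
  have h2 : nm y <= nm x + nm (x - y) by rewrite -{1}[y](subKr x) nmB.
  have h3 : C * nm y <= C * (nm x + nm (x - y)) by rewrite ler_wpM2l.
  have h4 : C * nm (x - y) <= C * (e / (C + 1)) by rewrite ler_wpM2l // ltW.
  have h5 : e = C * (e / (C + 1)) + e / (C + 1).
    by rewrite -{2}[e / (C + 1)]mul1r -mulrDl mulrC divfK //; apply: lt0r_neq0; lra.
  lra.
have /choice [T hT] x : exists w, cl x w.
  have small (e : R) : 0 < e -> exists N, forall n, (N <= n)%N -> n.+1%:R^-1 < e.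
    move=> e0; have [N _ /= HN] := near_infty_natSinv_lt (PosNum e0).
    by exists N => n Nn; exact: HN.
  have /choice [y yP] (n : nat) : exists y, exists u, G y u /\ nm (x - y) < n.+1%:R^-1.
    by apply: Gd; rewrite invr_gt0 ltr0n.
  have /choice [u uP] n : exists u, G (y n) u /\ nm (x - y n) < n.+1%:R^-1 by exact: yP.
  have GB n m : G (y n - y m) (u n - u m).
    have [Gn _] := uP n; have [Gm _] := uP m.
    by have := Glin (-1) _ _ _ _ Gm Gn; rewrite !scaleN1r !(addrC (- _)).
  have [|w hw] := @hilbert_complete _ F u.
    move=> e e0; have e1 : 0 < e / (2 * C + 2) by rewrite divr_gt0 //; lra.
    have [N HN] := small _ e1; exists N => m n /HN hm /HN hn.
    have [_ um] := uP m; have [_ un] := uP n; have hG := Gb _ _ (GB m n).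
    have h1 : nm (y m - y n) <= nm (x - y m) + nm (x - y n).
      by rewrite (nmBC x) -[y m - y n](subrKA x) nmD.
    have h2 : nm (y m - y n) <= 2 * (e / (2 * C + 2)).
      move: hm hn um un; move: (m.+1%:R^-1) (n.+1%:R^-1) => a b; lra.
    have h3 : C * nm (y m - y n) <= C * (2 * (e / (2 * C + 2))) by rewrite ler_wpM2l.
    have h5 : e = C * (2 * (e / (2 * C + 2))) + 2 * (e / (2 * C + 2)).
      by field; apply: lt0r_neq0; lra.
    lra.
  exists w => e e0; have [N1 H1] := small _ e0; have [N2 H2] := hw _ e0.
  pose n := maxn N1 N2; exists (y n), (u n); have [Gn hn] := uP n.
  split=> //; first by apply: lt_trans hn _; exact: H1 (leq_maxl _ _).
  by rewrite nmBC; apply: H2 (leq_maxr _ _).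
have uniq x w : cl x w -> T x = w.
  move=> h; apply/eqP; rewrite -subr_eq0; apply/eqP/nm_eq0/le_anti.
  rewrite nm_ge0 andbT; have := clb _ _ (cllin (-1) _ _ _ _ h (hT x)).
  by rewrite !scaleN1r !(addrC (- _)) subrr nm0 mulr0.
exists T; last by move=> x u /clG /uniq.
split; last by exists C => x; exact: clb.
by move=> a x y; apply: uniq; exact: cllin.
Qed.

End BoundedLinear.

(** * Adjoints, commutants and orthogonal projections *)

Section Adjoint.
Context {R : realType} {H : hilbertType R}.
Implicit Types (T S : H -> H).

Lemma adj_unique T S : (forall u v, '[T u, v] = '[u, S v]) -> adj T = S.
Proof.
move=> h; rewrite /adj; case: xgetP => [S' _ /= h'|/(_ S)] //.
by apply/funext => v; apply: dot_eq => u; rewrite -h -h'.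
Qed.

Lemma adjP T : blin T -> forall u v, '[T u, v] = '[u, adj T v].
Proof. by move=> /adjoint_exists [S _ h]; rewrite (adj_unique h). Qed.

Lemma adjPr T : blin T -> forall u v, '[adj T u, v] = '[u, T v].
Proof. by move=> bT u v; rewrite dotC -adjP // -dotC. Qed.

Lemma adj_blin T : blin T -> blin (adj T).
Proof. by move=> /adjoint_exists [S bS h]; rewrite (adj_unique h). Qed.

Lemma adjK T : blin T -> adj (adj T) = T.
Proof. by move=> bT; apply: adj_unique => u v; rewrite adjPr. Qed.

Lemma adj_comp S T : blin S -> blin T -> adj (S \o T) = adj T \o adj S.
Proof. by move=> bS bT; apply: adj_unique => u v; rewrite /= !adjP. Qed.

Lemma adj_id : adj (idfun : H -> H) = idfun.
Proof. exact: adj_unique. Qed.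

Lemma commutant_adj (A : set (H -> H)) T :
  (forall S, A S -> blin S) -> (forall S, A S -> A (adj S)) ->
  commutant A T -> commutant A (adj T).
Proof.
rewrite /commutant bounded_opE => bA sA [bT cT]; split; first exact: adj_blin.
move=> S AS; have bS := bA _ AS.
rewrite -[S](adjK bS) -adj_comp //; last exact: adj_blin.
rewrite -(cT _ (sA _ AS)) adj_comp //; exact: adj_blin.
Qed.

Lemma commutant_blin (A : set (H -> H)) T : commutant A T -> blin T.
Proof. by rewrite /commutant bounded_opE => -[]. Qed.

Lemma commutant_comm (A : set (H -> H)) T S x : commutant A T -> A S -> T (S x) = S (T x).
Proof. by move=> [_ h] /h /(congr1 (@^~ x)). Qed.

Lemma commutantI (A : set (H -> H)) T : blin T ->
  (forall S x, A S -> T (S x) = S (T x)) -> commutant A T.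
Proof.
move=> bT h; rewrite /commutant bounded_opE; split=> // S AS.
by apply/funext => x /=; exact: h.
Qed.

Lemma proj_exists (W : set H) : closed_subspace W ->
  exists P : H -> H, [/\ blin P, forall x, W (P x), forall x w, W w -> '[x - P x, w] = 0,
    forall x y, '[P x, y] = '[x, P y] & forall x, W x -> P x = x].
Proof.
move=> [W0 WD WZ Wc].
have Wlin a x y : W x -> W y -> W (a *: x + y) by move=> Wx Wy; apply: WD => //; exact: WZ.
have [P [lP WP oP sP fP]] := @projection_exists _ _ _ (@dot_linear _ H) (@dotC _ H)
  (@dot_ge0 _ H) (@dot_def _ H) W W0 Wlin (closed_complete Wc).
exists P; split=> //; split=> //; exists 1 => x; rewrite mul1r.
rewrite -ler_sqr ?nnegrE ?nm_ge0 // -!nm2E.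
exact: (@projection_le _ _ _ (@dot_linear _ H) (@dotC _ H) (@dot_ge0 _ H) x (P x) (oP _ _ (WP x))).
Qed.

Lemma closed_subspaceB (W : set H) x y : closed_subspace W -> W x -> W y -> W (x - y).
Proof. by move=> [_ WD WZ _] Wx Wy; rewrite -scaleN1r; apply: WD => //; exact: WZ. Qed.

Lemma proj_comm (W : set H) (P T : H -> H) : closed_subspace W ->
  (forall x, W (P x)) -> (forall x w, W w -> '[x - P x, w] = 0) -> blin T ->
  (forall x, W x -> W (T x)) -> (forall x, W x -> W (adj T x)) ->
  forall x, P (T x) = T (P x).
Proof.
move=> cW WP oP bT WT WT' x.
apply: (@projection_comm _ _ _ (@dot_linear _ H) (@dot_def _ H) W P T (adj T)) => //.
- by move=> y z; exact: linB (blin_lin bT).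
- exact: adjP.
- by move=> y z; exact: closed_subspaceB.
Qed.

End Adjoint.

(** * Positive operators and von Neumann algebras *)

Section PositiveOperators.
Context {R : realType} {H : hilbertType R}.
Implicit Types (a b c T S : H -> H) (u v : H).

Definition rq T u : R := Re '[T u, u].

Definition psd T := blin T /\ op_le 0 T.

Lemma dot0l u : '[0, u] = 0 :> R[i].
Proof. by rewrite linear0l. Qed.

Lemma psd_blin T : psd T -> blin T.
Proof. by case. Qed.

Lemma dotDl (x y z : H) : '[x + y, z] = '[x, z] + '[y, z].
Proof. by rewrite -[x]scale1r dot_linear mul1r scale1r. Qed.

Lemma dotZl t (x z : H) : '[t *: x, z] = t * '[x, z].
Proof. by rewrite -[_ *: _]addr0 dot_linear dot0l addr0. Qed.

Lemma dotDr (x y z : H) : '[z, x + y] = '[z, x] + '[z, y].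
Proof. by rewrite dotC dotDl rmorphD /= -!dotC. Qed.

Lemma dotZr t (x z : H) : '[z, t *: x] = (t^* )%R * '[z, x].
Proof. by rewrite dotC dotZl rmorphM /= -dotC. Qed.

Lemma dotBl (x y z : H) : '[x - y, z] = '[x, z] - '[y, z].
Proof. by rewrite dotDl -scaleN1r dotZl mulN1r. Qed.

Lemma dotBr (x y z : H) : '[z, x - y] = '[z, x] - '[z, y].
Proof. by rewrite dotC dotBl rmorphB /= -!dotC. Qed.

Lemma dot0r u : '[u, 0] = 0 :> R[i].
Proof. by rewrite dotC dot0l rmorph0. Qed.

(** Replacing [u] by ['i *: u] flips the relative sign of the two cross terms of the form at u + v,
    which leaves 2 i <T u, v> = 0. *)
Lemma polarization T : linear T -> (forall u, '[T u, u] = 0) -> T = 0.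
Proof.
move=> lT h; apply/funext => u; apply: dot_eql => v; rewrite dot0l.
have add w : '[T w, v] + '[T v, w] = 0.
  by have := h (w + v); rewrite (linD _ _ lT) dotDl !dotDr !h add0r addr0.
have := add ('i *: u); have := add u.
rewrite (linZ _ _ lT) dotZl dotZr.
have -> : ('i^*)%R = - 'i :> R[i] by rewrite /= -[RHS]/(Complex (- 0) (- 1)) oppr0.
move=> /eqP; rewrite addrC addr_eq0 => /eqP ->.
rewrite mulrN mulNr opprK -mulrDl => /eqP; rewrite mulf_eq0 => /orP[|/eqP //].
by rewrite -mulr2n mulrn_eq0 eq_complex /= oner_eq0 andbF.
Qed.

Lemma sa_dotE T u : blin T -> adj T = T -> '[T u, u] = (rq T u)%:C.
Proof.
move=> bT sT; have : '[T u, u] = ('[T u, u]^* )%R by rewrite -dotC [LHS](adjP bT) sT.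
rewrite /rq; case: ('[T u, u]) => x y /= [] /eqP; rewrite eq_sym.
by rewrite eqNr => /eqP ->.
Qed.

Lemma op_leE a b : blin a -> adj a = a -> blin b -> adj b = b ->
  op_le a b <-> forall u, rq a u <= rq b u.
Proof.
move=> ba sa bb sb; split=> h u; first by have := h u; rewrite lecE => /andP[].
by rewrite !sa_dotE // lecR.
Qed.

Lemma op_le_trans a b c : op_le a b -> op_le b c -> op_le a c.
Proof. by move=> ab bc u; apply: le_trans (ab u) (bc u). Qed.

(** The order of [R[i]] forces <T u, u> to be real, so the quadratic form of T - adj T vanishes and
    polarization applies. *)
Lemma psd_adj T : psd T -> adj T = T.
Proof.
move=> [bT pT]; have bA := adj_blin bT.
have /polarization : linear (T - adj T) by exact: blin_lin (blinB bT bA).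
move=> h; apply/esym/eqP; rewrite -subr_eq0; apply/eqP/h => u.
have := pT u; rewrite ?fctE dot0l => /ge0_complex e.
by rewrite dotBl adjPr // (dotC (T u) u) e conj_real subrr.
Qed.

Lemma psdE T u : psd T -> '[T u, u] = (rq T u)%:C.
Proof. by move=> pT; apply: sa_dotE; [exact: psd_blin | exact: psd_adj]. Qed.

Lemma rq_ge0 T u : psd T -> 0 <= rq T u.
Proof. by move=> [_ /(_ u)]; rewrite ?fctE dot0l lecE => /andP[]. Qed.

Lemma psdP T : blin T -> adj T = T -> (forall u, 0 <= rq T u) -> psd T.
Proof.
by move=> bT sT h; split=> // u; rewrite ?fctE dot0l sa_dotE // ler0c.
Qed.

Lemma op_leP a b : psd a -> psd b -> op_le a b <-> forall u, rq a u <= rq b u.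
Proof. by move=> pa pb; apply: op_leE; rewrite ?psd_adj; try exact: psd_blin. Qed.

Lemma rqD a b u : rq (a + b) u = rq a u + rq b u.
Proof. by rewrite /rq !fctE dotDl ReD. Qed.

Lemma rqB a b u : rq (a - b) u = rq a u - rq b u.
Proof. by rewrite /rq !fctE dotBl ReD ReN. Qed.

Lemma rqZ (t : R) a u : rq (t%:C *: a) u = t * rq a u.
Proof. by rewrite /rq !fctE dotZl ReM_real. Qed.

Lemma psd0 : psd (0 : H -> H).
Proof. by split; [exact: blin0 | move=> u]. Qed.

Lemma psdD a b : psd a -> psd b -> psd (a + b).
Proof.
move=> pa pb; split; first by apply: blinD; exact: psd_blin.
move=> u; rewrite ?fctE dotDl dot0l addr_ge0 // psdE // ler0c; exact: rq_ge0.
Qed.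

Lemma psdZ (t : R) a : 0 <= t -> psd a -> psd (t%:C *: a).
Proof.
move=> t0 pa; split; first by apply: blinZ; exact: psd_blin.
move=> u; rewrite ?fctE dotZl dot0l mulr_ge0 ?ler0c // psdE // ler0c; exact: rq_ge0.
Qed.

Lemma psdB a b : psd a -> psd b -> op_le a b -> psd (b - a).
Proof.
move=> pa pb ab; split; first by apply: blinB; exact: psd_blin.
by move=> u; rewrite ?fctE dotBl dot0l subr_ge0; exact: ab.
Qed.

Lemma psd_sq a : psd a -> psd (a \o a).
Proof.
move=> pa; have ba := psd_blin pa; split; first exact: blin_comp.
by move=> u; rewrite ?fctE /= dot0l -{1}(psd_adj pa) adjPr // dot_ge0.
Qed.

Lemma psd_conj a S : psd a -> blin S -> psd (adj S \o a \o S).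
Proof.
move=> pa bS; have bA := adj_blin bS; split.
  by apply: blin_comp => //; apply: blin_comp => //; exact: psd_blin.
by move=> u; rewrite ?fctE /= dot0l adjPr // psdE // ler0c; exact: rq_ge0.
Qed.

Lemma psd_adjM S : blin S -> psd (adj S \o S).
Proof.
move=> bS; have bA := adj_blin bS; split; first exact: blin_comp.
by move=> u; rewrite ?fctE /= dot0l adjPr // dot_ge0.
Qed.

Lemma psd_eq a b : psd a -> psd b -> op_le a b -> op_le b a -> a = b.
Proof.
move=> pa pb ab ba; apply/eqP; rewrite -subr_eq0; apply/eqP/polarization.
  by apply: blin_lin; apply: blinB; exact: psd_blin.
move=> u; rewrite ?fctE dotBl; apply/eqP; rewrite subr_eq0; apply/eqP/le_anti.
by rewrite ab ba.
Qed.

(** Cauchy-Schwarz for the form <c x, y> at [u] and [c u]. This is the operator inequality c^2 <= K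
    c. *)
Lemma psd_nm2 c (K : R) : psd c -> (forall u, rq c u <= K * nm u ^+ 2) ->
  forall u, nm (c u) ^+ 2 <= K * rq c u.
Proof.
move=> pc hK u; have [bc _] := pc.
have h : (nm (c u) ^+ 2) ^+ 2 <= rq c u * rq c (c u).
  rewrite -[nm _ ^+ 2]nm2E; apply: (@dCS _ _ (fun x y => '[c x, y])).
  - by move=> t x y z; rewrite (blin_lin bc) dot_linear.
  - by move=> x y; rewrite -dotC adjP // psd_adj.
  - by move=> x; rewrite psdE // ler0c; exact: rq_ge0.
have r0 := rq_ge0 u pc.
have [c0|c0] := eqVneq (nm (c u)) 0.
  rewrite c0 expr0n; have [u0|u0] := eqVneq (nm u) 0.
    have -> : rq c u = 0 by have := hK u; rewrite u0 expr0n mulr0; lra.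
    by rewrite mulr0.
  have : 0 < nm u ^+ 2 by rewrite exprn_gt0 // lt_def u0 nm_ge0.
  move: (hK u) r0; move: (nm u ^+ 2) (rq c u) => x y *; apply: mulr_ge0 => //; nra.
have n0 : 0 < nm (c u) ^+ 2 by rewrite exprn_gt0 // lt_def c0 nm_ge0.
have := hK (c u); have := rq_ge0 u pc; move: n0 h.
move: (nm (c u) ^+ 2) (rq c u) (rq c (c u)) => x y z x0 h y0 hz.
rewrite -(ler_pM2r x0) -expr2; apply: le_trans h _.
by rewrite [K * y]mulrC -mulrA ler_wpM2l.
Qed.

Lemma rq_bound b : blin b -> exists2 K : R, 0 < K & forall u, rq b u <= K * nm u ^+ 2.
Proof.
move=> /blin_bound [C C0 hC]; exists C => // u.
apply: le_trans (ler_norm _) _; apply: le_trans (Re_dot_le _ _) _.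
by rewrite expr2 mulrA ler_wpM2r // nm_ge0.
Qed.

Lemma Re_dot_sub x y u : `|Re '[x, u] - Re '[y, u]| <= nm (x - y) * nm u.
Proof. by rewrite -ReN -ReD -dotBl Re_dot_le. Qed.

Lemma sa_Re T : blin T -> (forall u v, Re '[T u, v] = Re '[u, T v]) -> adj T = T.
Proof.
move=> bT h; apply: adj_unique => u v; apply: complex_eq; first exact: h.
by rewrite -!dotZl -(linZ _ _ (blin_lin bT)) h.
Qed.

End PositiveOperators.

(** * Von Neumann algebras: closure properties and monotone limits *)

Section VonNeumann.
Context {R : realType} {H : hilbertType R} (M : set (H -> H)).
Hypothesis vM : von_neumann_algebra M.
Implicit Types (S T : H -> H).

Lemma vn_blin T : M T -> blin T.
Proof. by case: vM => _ <- /commutant_blin. Qed.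

Lemma vn_adj T : M T -> M (adj T).
Proof. by case: vM => h _; exact: h. Qed.

Lemma vn_commute T S x : M T -> commutant M S -> T (S x) = S (T x).
Proof. by move=> MT cS; rewrite (commutant_comm x cS MT). Qed.

Lemma vn_mem T : blin T -> (forall S x, commutant M S -> T (S x) = S (T x)) -> M T.
Proof. by move=> bT h; case: vM => _ <-; exact: commutantI. Qed.

Lemma vn_linear t S T : M S -> M T -> M (t *: S + T).
Proof.
move=> MS MT; apply: vn_mem; first by apply: blin_linear; exact: vn_blin.
move=> Q x cQ; rewrite ?fctE !(vn_commute x _ cQ) //.
by rewrite (blin_lin (commutant_blin cQ)).
Qed.

Lemma vn_id : M idfun.
Proof. by apply: vn_mem => //; exact: blin_id. Qed.

Lemma vn0 : M 0.
Proof.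
apply: vn_mem; first exact: blin0.
by move=> S x /commutant_blin bS; rewrite ?fctE (lin0 (blin_lin bS)).
Qed.

Lemma vnD S T : M S -> M T -> M (S + T).
Proof. by move=> MS MT; rewrite -[S]scale1r; exact: vn_linear. Qed.

Lemma vnZ t S : M S -> M (t *: S).
Proof. by move=> MS; rewrite -[_ *: _]addr0; apply: vn_linear => //; exact: vn0. Qed.

Lemma vnB S T : M S -> M T -> M (S - T).
Proof. by move=> MS MT; rewrite addrC -scaleN1r; exact: vn_linear. Qed.

Lemma vn_comp S T : M S -> M T -> M (S \o T).
Proof.
move=> MS MT; apply: vn_mem; first by apply: blin_comp; exact: vn_blin.
by move=> Q x cQ; rewrite /= (vn_commute x MT cQ) (vn_commute _ MS cQ).
Qed.

Lemma vn_commutant_adj T : commutant M T -> commutant M (adj T).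
Proof. by apply: commutant_adj; [exact: vn_blin | exact: vn_adj]. Qed.

(** A chain of positive elements of M with its strong limit [T]. Chains are what Zorn's lemma asks
    for. Approximation at one vector at a time, together with the upper bound property, already
    makes [T] the least upper bound. *)
Record chain_sup (D : set (H -> H)) T : Prop := {
  chain_nonempty : D !=set0;
  chain_total : total_on D op_le;
  chain_mem : forall a, D a -> M a /\ psd a;
  sup_mem : M T /\ psd T;
  sup_ub : forall a, D a -> op_le a T;
  sup_strong : forall u (e : R), 0 < e -> exists2 a, D a & nm (T u - a u) < e
}.

(** Monotone convergence. For a <= a' in the chain, a' - a is below [b], hence |(a' - a) u|^2 <= K
    (rq a' u - rq a u): strong convergence at [u] follows from the convergence of the bounded
    monotone numbers rq a u. *)
Lemma chain_sup_exists (D : set (H -> H)) b : D !=set0 -> total_on D op_le ->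
  (forall a, D a -> [/\ M a, psd a & op_le a b]) -> psd b ->
  exists2 T, chain_sup D T & op_le T b.
Proof.
move=> [a0 Da0] tD DM pb; have [K K0 hK] := rq_bound (psd_blin pb).
(* Properties holding eventually along the chain; totality of the order makes them stable under
   conjunction. *)
pose Ev (P : (H -> H) -> Prop) := exists2 a, D a & forall a', D a' -> op_le a a' -> P a'.
have EvI P Q : Ev P -> Ev Q -> Ev (fun a => P a /\ Q a).
  move=> [a Da ha] [c Dc hc]; have [ac|ca] := tD _ _ Da Dc.
    exists c => // a' Da' ca'; split; last exact: hc.
    by apply: ha => //; exact: op_le_trans ca'.
  exists a => // a' Da' aa'; split; first exact: ha.
  by apply: hc => //; exact: op_le_trans aa'.
have EvE P : Ev P -> exists2 a, D a & P a by move=> [a Da ha]; exists a => //; exact: ha.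
have Dp a : D a -> psd a by move=> /DM [].
have DB a a' u : D a -> D a' -> op_le a a' -> nm (a' u - a u) ^+ 2 <= K * (rq a' u - rq a u).
  move=> Da Da' aa'; have := @psd_nm2 _ _ (a' - a) K (psdB (Dp _ Da) (Dp _ Da') aa').
  rewrite -rqB; apply => v; rewrite rqB; apply: le_trans (hK v).
  have [_ _ /op_leP ab] := DM _ Da'.
  have := ab (Dp _ Da') pb v; have := rq_ge0 v (Dp _ Da); lra.
have Db a u : D a -> nm (a u) <= K * nm u.
  move=> Da; have [_ pa /op_leP ab] := DM _ Da.
  rewrite -ler_sqr ?nnegrE ?mulr_ge0 ?nm_ge0 ?(ltW K0) // exprMn.
  apply: le_trans (_ : K * rq a u <= _).
    by apply: psd_nm2 => // v; exact: le_trans (ab pa pb v) (hK v).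
  by rewrite expr2 -mulrA; apply: ler_wpM2l (le_trans (ab pa pb u) (hK u)); exact: ltW.
(* The approximating sequence [c] depends on [u]. Recording the limit through [Ev] makes the values
   at different vectors comparable, whence the linearity of [T]. *)
have /choice [T hT] u : exists w, forall e : R, 0 < e -> Ev (fun a => nm (w - a u) < e).
  have small (e : R) : 0 < e -> exists N, forall n, (N <= n)%N -> K * n.+1%:R^-1 < e.
    move=> e0; have eK : 0 < e / K by rewrite divr_gt0.
    have [N _ /= HN] := near_infty_natSinv_lt (PosNum eK).
    by exists N => n Nn; rewrite mulrC -ltr_pdivlMr //; exact: HN.
  have hs : has_sup [set rq a u | a in D].
    split; first by exists (rq a0 u), a0.
    exists (rq b u) => _ [a Da <-].
    by have [_ pa /op_leP ab] := DM _ Da; exact: ab.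
  set F := sup [set rq a u | a in D].
  have Fub a : D a -> rq a u <= F by move=> Da; apply: ub_le_sup; [exact: hs.2 | exists a].
  have /choice [c cP] (n : nat) : exists c, D c /\ F - n.+1%:R^-1 < rq c u.
    have [|_ [c Dc <-] h] := @sup_adherent _ _ (n.+1%:R^-1 : R) _ hs.
      by rewrite invr_gt0 ltr0n.
    by exists c.
  have cB n a : D a -> op_le (c n) a -> nm (a u - c n u) ^+ 2 <= K * n.+1%:R^-1.
    move=> Da ca; have [Dc Fc] := cP n; apply: le_trans (DB _ _ _ Dc Da ca) _.
    apply: ler_wpM2l; first exact: ltW.
    by have := Fub _ Da; move: Fc; move: (n.+1%:R^-1) => x; lra.
  have sq_lt (x e : R) : 0 <= x -> 0 < e -> x ^+ 2 < e ^+ 2 -> x < e.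
    by move=> x0 e0; rewrite ltr_pXn2r // nnegrE // ltW.
  have [|w hw] := @hilbert_complete _ _ (fun n => c n u).
    move=> e e0; have [|N HN] := small (e ^+ 2); first by rewrite exprn_gt0.
    exists N => m n Nm Nn; have [Dm _] := cP m; have [Dn _] := cP n.
    apply: sq_lt => //; first exact: nm_ge0.
    have [mn|nm'] := tD _ _ Dm Dn.
      by rewrite nmBC; apply: le_lt_trans (cB _ _ Dn mn) _; exact: HN.
    by apply: le_lt_trans (cB _ _ Dm nm') _; exact: HN.
  exists w => e e0; have e2 : 0 < e / 2 by lra.
  have [|N1 H1] := small ((e / 2) ^+ 2); first by rewrite exprn_gt0.
  have [N2 H2] := hw _ e2; pose n := maxn N1 N2; have [Dc _] := cP n.
  exists (c n) => // a Da ca.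
  have h1 : nm (a u - c n u) < e / 2.
    apply: sq_lt => //; first exact: nm_ge0.
    by apply: le_lt_trans (cB _ _ Da ca) _; exact: H1 (leq_maxl _ _).
  have h2 := H2 n (leq_maxr _ _).
  have : nm (w - a u) <= nm (c n u - w) + nm (a u - c n u).
    by rewrite (nmBC (c n u)) (nmBC (a u)) -[w - a u](subrKA (c n u)) nmD.
  lra.
have eq_small (x y : H) (k : R) : 0 <= k ->
    (forall e : R, 0 < e -> nm (x - y) <= k * e) -> x = y.
  move=> k0 h; apply/eqP; rewrite -subr_eq0; apply/eqP/nm_eq0/le_anti.
  rewrite nm_ge0 andbT; apply/ler_addgt0Pr => e e0; rewrite add0r.
  have k1 : 0 < e / (k + 1) by rewrite divr_gt0 //; lra.
  apply: le_trans (h _ k1) _; rewrite mulrCA -{2}[e]mulr1 ler_wpM2l ?ltW //.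
  by rewrite ltr_pdivrMr; lra.
have Tlin : linear T.
  move=> t u v; pose k := Re `|t|.
  have t0 : 0 <= k by have := normr_ge0 t; rewrite lecE => /andP[].
  apply: (eq_small _ _ (k + 2)); first by lra.
  move=> e e0.
  have [a Da [h1 [h2 h3]]] := EvE _ (EvI _ _ (hT (t *: u + v) _ e0)
     (EvI _ _ (hT u _ e0) (hT v _ e0))).
  have la := blin_lin (psd_blin (Dp _ Da)).
  have -> : T (t *: u + v) - (t *: T u + T v) =
    (T (t *: u + v) - a (t *: u + v)) - (t *: (T u - a u) + (T v - a v)).
    by rewrite la scalerBr (addrACA (t *: T u)) -opprD opprB addrA subrK.
  apply: le_trans (nmB _ _) _; apply: le_trans (lerD (ltW h1) (nmD _ _)) _.
  rewrite nmZ -/k; have : k * nm (T u - a u) <= k * e by rewrite ler_wpM2l // ltW.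
  by lra.
have Tb : blin T.
  split=> //; exists K => u; apply/ler_addgt0Pr => e e0.
  have [a Da h] := EvE _ (hT u _ e0); have := Db _ u Da.
  have : nm (T u) <= nm (T u - a u) + nm (a u) by rewrite -{1}[T u](subrK (a u)) nmD.
  lra.
have small_le (x y k : R) : 0 <= k -> (forall e : R, 0 < e -> x - y <= e * k) -> x <= y.
  move=> k0 h; apply/ler_addgt0Pr => e e0.
  have k1 : 0 < e / (k + 1) by rewrite divr_gt0 //; lra.
  have := h _ k1; have : e / (k + 1) * k <= e by rewrite mulrAC ler_pdivrMr; nra.
  lra.
have Tsa : adj T = T.
  apply: sa_Re => // u v; apply/eqP; rewrite -subr_eq0 -normr_eq0; apply/eqP/le_anti.
  rewrite normr_ge0 andbT; apply: (small_le _ _ (nm u + nm v)).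
    by rewrite addr_ge0 // nm_ge0.
  move=> e e0; rewrite subr0.
  have [a Da [h1 h2]] := EvE _ (EvI _ _ (hT u _ e0) (hT v _ e0)).
  have sa : '[a u, v] = '[u, a v] by rewrite (adjP (psd_blin (Dp _ Da))) (psd_adj (Dp _ Da)).
  have -> : Re '[T u, v] - Re '[u, T v] = Re '[T u - a u, v] - Re '[u, T v - a v].
    by rewrite dotBl dotBr sa !ReD !ReN; ring.
  apply: le_trans (ler_normB _ _) _.
  have := Re_dot_le (T u - a u) v; have := Re_dot_le u (T v - a v).
  have := nm_ge0 u; have := nm_ge0 v; nra.
have close u e : 0 < e -> Ev (fun a => `|rq T u - rq a u| <= e * nm u).
  move=> /(hT u) [a Da ha]; exists a => // a' Da' aa'.
  apply: le_trans (Re_dot_sub _ _ _) _.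
  by rewrite ler_wpM2r ?nm_ge0 // ltW //; exact: ha.
have Tub a u : D a -> rq a u <= rq T u.
  move=> Da; apply: (small_le _ _ (nm u)) (nm_ge0 u) _ => e e0.
  have Eva : Ev (fun a' => op_le a a') by exists a.
  have [c Dc [h1 /op_leP h2]] := EvE _ (EvI _ _ (close u _ e0) Eva).
  have := h2 (Dp _ Da) (Dp _ Dc) u; move: h1; rewrite distrC ler_norml => /andP[_].
  lra.
have Tpsd : psd T.
  by apply: psdP => // u; exact: le_trans (rq_ge0 u (Dp _ Da0)) (Tub _ u Da0).
have TM : M T.
  apply: vn_mem => // S x cS; have bS := commutant_blin cS.
  have [C C0 hC] := blin_bound bS.
  apply: (eq_small _ _ (1 + C)) => [|e e0]; first by lra.
  have [a Da [h1 h2]] := EvE _ (EvI _ _ (hT (S x) _ e0) (hT x _ e0)).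
  have [Ma _ _] := DM _ Da.
  have -> : T (S x) - S (T x) = (T (S x) - a (S x)) - S (T x - a x).
    by rewrite (linB _ _ (blin_lin bS)) opprB (vn_commute x Ma cS) addrA subrK.
  apply: le_trans (nmB _ _) _; have := hC (T x - a x); nra.
exists T; last first.
  apply/op_leP => // u; apply: (small_le _ _ (nm u)) (nm_ge0 u) _ => e e0.
  have [c Dc h1] := EvE _ (close u _ e0).
  have [_ pc /op_leP h2] := DM _ Dc.
  have := h2 pc pb u; move: h1; rewrite ler_norml => /andP[_].
  lra.
split=> //; first by exists a0.
- by move=> a /DM [].
- by move=> a Da; apply/op_leP => //; [exact: Dp | move=> u; exact: Tub].
- by move=> u e /(hT u) /EvE.
Qed.

End VonNeumann.

(** * Normal functionals *)

Section Trace.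
Context {R : realType} {H : hilbertType R} (M : set (H -> H)) (tau : (H -> H) -> R[i]).
Hypothesis vM : von_neumann_algebra M.
Hypothesis ft : faithful_normal_trace M tau.
Implicit Types (a b d r x y : H -> H).

Definition tr a : R := Re (tau a).

Lemma tr_comm x y : M x -> M y -> tr (x \o y) = tr (y \o x).
Proof. by move=> Mx My; rewrite /tr (trace_comm ft). Qed.

(** Axioms on the positive cone of M and normality along chains: the form in which the maximality
    argument uses them, shared by the trace and the vector functionals. *)
Record normal_functional (phi : (H -> H) -> R) : Prop := {
  nf_add : forall a b, M a -> psd a -> M b -> psd b -> phi (a + b) = phi a + phi b;
  nf_scale : forall (t : R) a, 0 <= t -> M a -> psd a -> phi (t%:C *: a) = t * phi a;
  nf_ge0 : forall a, M a -> psd a -> 0 <= phi a;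
  nf_normal : forall D T, chain_sup M D T -> forall e : R, 0 < e ->
    exists2 a, D a & phi T - phi a < e
}.

Lemma nf_zero phi : normal_functional phi -> phi 0 = 0.
Proof.
move=> nf; have := nf_scale nf (lexx 0) (vn0 vM) psd0.
by rewrite scaler0 mul0r.
Qed.

Lemma nf_le phi a b : normal_functional phi -> M a -> psd a -> M b -> psd b ->
  op_le a b -> phi a <= phi b.
Proof.
move=> nf Ma pa Mb pb ab; have pab := psdB pa pb ab; have Mab := vnB vM Mb Ma.
by rewrite -[b](subrK a) (nf_add nf) // lerDr (nf_ge0 nf).
Qed.

Lemma nf_mul phi (c : R) : 0 <= c -> normal_functional phi ->
  normal_functional (fun a => c * phi a).
Proof.
move=> c0 nf; split.
- by move=> a b *; rewrite (nf_add nf) // mulrDr.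
- by move=> t a *; rewrite (nf_scale nf) // mulrCA.
- by move=> a Ma pa; rewrite mulr_ge0 // (nf_ge0 nf).
move=> D T DT e e0; have e1 : 0 < e / (c + 1) by rewrite divr_gt0 //; lra.
have [a Da h] := nf_normal nf DT e1; exists a => //; rewrite -mulrBr.
apply: le_lt_trans (_ : c * (e / (c + 1)) < e); first by rewrite ler_wpM2l // ltW.
by rewrite mulrA ltr_pdivrMr; nra.
Qed.

(** Since phi (T - a) <= psi (T - a), an element of the chain that approximates for [psi] does so
    for [phi]. *)
Lemma nf_dominated phi psi :
  (forall a b, M a -> psd a -> M b -> psd b -> phi (a + b) = phi a + phi b) ->
  (forall (t : R) a, 0 <= t -> M a -> psd a -> phi (t%:C *: a) = t * phi a) ->
  (forall a, M a -> psd a -> 0 <= phi a <= psi a) ->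
  normal_functional psi -> normal_functional phi.
Proof.
move=> pD pZ ple nf; split=> //; first by move=> a Ma /(ple _ Ma) /andP[].
move=> D T DT e /(nf_normal nf DT) [a Da h]; exists a => //.
have [Ma pa] := chain_mem DT Da; have [MT pT] := sup_mem DT.
have pTa := psdB pa pT (sup_ub DT Da); have MTa := vnB vM MT Ma.
apply: le_lt_trans h; move: (ple _ MTa pTa) => /andP[_].
have := pD _ _ MTa pTa Ma pa; have := nf_add nf MTa pTa Ma pa; rewrite !subrK.
lra.
Qed.

Lemma nf_vector h : normal_functional (fun a => rq a h).
Proof.
split.
- by move=> *; rewrite rqD.
- by move=> *; rewrite rqZ.
- by move=> a _; exact: rq_ge0.
move=> D T DT e e0; have e1 : 0 < e / (nm h + 1) by rewrite divr_gt0 // ltr_wpDl ?nm_ge0.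
have [a Da hh] := sup_strong DT h e1; exists a => //.
apply: le_lt_trans (ler_norm _) _; apply: le_lt_trans (Re_dot_sub _ _ _) _.
have n0 := nm_ge0 h; apply: le_lt_trans (_ : e / (nm h + 1) * nm h < _).
  by rewrite ler_wpM2r // ltW.
by rewrite mulrAC ltr_pdivrMr; nra.
Qed.

Lemma tau_ge0 a : M a -> psd a -> 0 <= tau a.
Proof. by move=> Ma [_]; exact: (trace_positive ft). Qed.

Lemma tauE a : M a -> psd a -> tau a = (tr a)%:C.
Proof. by move=> Ma pa; apply: ge0_complex; exact: tau_ge0. Qed.

Lemma tauD a b : M a -> M b -> tau (a + b) = tau a + tau b.
Proof. by move=> Ma Mb; rewrite -[a]scale1r (trace_linear ft) // scale1r mul1r. Qed.

Lemma tau0 : tau 0 = 0.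
Proof. by apply: (addrI (tau 0)); rewrite -tauD ?addr0 //; exact: vn0. Qed.

Lemma tauZ t a : M a -> tau (t *: a) = t * tau a.
Proof.
by move=> Ma; rewrite -[_ *: _]addr0 (trace_linear ft) ?tau0 ?addr0 //; exact: vn0.
Qed.

Lemma tauB a b : M a -> M b -> tau (a - b) = tau a - tau b.
Proof. by move=> Ma Mb; rewrite addrC -scaleN1r (trace_linear ft) // mulN1r addrC. Qed.

Lemma psd_id : psd (idfun : H -> H).
Proof. by split; [exact: blin_id | move=> u; rewrite ?fctE dot0l; exact: dot_ge0]. Qed.

(** Strong approximation shows that the limit [T] of a chain is its supremum in M. If no element of
    the chain came within [e], tau T - e would be an upper bound of the traces below their
    supremum. *)
Lemma nf_tr : normal_functional tr.
Proof.
have pos a : M a -> psd a -> 0 <= tr a.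
  by move=> Ma pa; have := tau_ge0 Ma pa; rewrite lecE => /andP[].
split=> //.
- by move=> a b *; rewrite /tr tauD // ReD.
- by move=> t a *; rewrite /tr tauZ // ReM_real.
move=> D T DT e e0; apply: contrapT => none.
have [MT pT] := sup_mem DT.
have sa a : M a -> psd a -> (M `&` selfadjoint) a.
  by move=> Ma pa; split=> //; split; [rewrite bounded_opE; exact: psd_blin | exact: psd_adj].
have [_ /(_ (tau T - e%:C))] : supremums (tau @` D) (tau T).
  apply: (trace_normal ft).
  - by move=> a /(chain_mem DT) [Ma pa]; exact: sa.
  - split; first exact: chain_nonempty DT.
    move=> a b Da Db; have [ab|ba] := chain_total DT Da Db; first by exists b => //; split.
    by exists a => //; split.
  split; first exact: sa; first exact: sup_ub DT.
  move=> Q [MQ [bQ sQ]] Qub; rewrite bounded_opE in bQ.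
  apply/op_leE => //; [exact: psd_blin | exact: psd_adj|].
  move=> u; apply/ler_addgt0Pr => d d0; have [a Da h] := nf_normal (nf_vector u) DT d0.
  have [Ma pa] := chain_mem DT Da.
  move: (Qub _ Da) => /op_leE; rewrite psd_adj // => /(_ (psd_blin pa) erefl bQ sQ u).
  by move: h => /=; lra.
move=> h; have : tau T <= tau T - e%:C.
  apply: h => _ [a Da <-]; have [Ma pa] := chain_mem DT Da.
  rewrite !tauE // -rmorphB lecR leNgt; apply/negP => h; apply: none.
  by exists a => //; move: h; rewrite /=; lra.
by rewrite tauE // -rmorphB lecR; lra.
Qed.

(** |y r u|^2 is at most a multiple of |r u|^2, hence of <r u, u>. Such elements are the ones on
    which the comparisons obtained by exhaustion below [r] are evaluated. *)
Lemma op_le_sandwich r y : psd r -> blin y ->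
  exists2 k : R, 0 < k & op_le (r \o adj y \o y \o r) (k%:C *: r).
Proof.
move=> pr bY; have br := psd_blin pr.
have [K K0 hK] := rq_bound br; have [C C0 hC] := blin_bound bY.
exists (C ^+ 2 * K) => [|u]; first by rewrite mulr_gt0 // exprn_gt0.
rewrite ?fctE dotZl psdE // -rmorphM /= -{1}(psd_adj pr) adjPr // adjPr //.
rewrite dotE lecR -mulrA; apply: le_trans (_ : C ^+ 2 * nm (r u) ^+ 2 <= _).
  by rewrite -exprMn lerXn2r ?nnegrE ?mulr_ge0 ?nm_ge0 // ltW.
by rewrite ler_wpM2l ?sqr_ge0 //; exact: psd_nm2.
Qed.

Lemma psd_sandwich r y : psd r -> blin y -> psd (r \o adj y \o y \o r).
Proof.
move=> pr bY; have := psd_adjM (blin_comp bY (psd_blin pr)).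
by rewrite adj_comp ?(psd_adj pr) //; exact: psd_blin.
Qed.

Lemma vn_sandwich r y : M r -> M y -> M (r \o adj y \o y \o r).
Proof.
move=> Mr My.
exact: (vn_comp vM (vn_comp vM (vn_comp vM Mr (vn_adj vM My)) My) Mr).
Qed.

(** Faithfulness concerns tau (a^2), and a^2 is below a multiple of [a]: the sandwich bound with y =
    1. *)
Lemma tr_eq0 a : M a -> psd a -> tr a = 0 -> a = 0.
Proof.
move=> Ma pa t0; apply: (trace_faithful ft) => //; rewrite psd_adj //.
have [k k0] := op_le_sandwich pa (@blin_id _ H); rewrite adj_id => ak.
have paa : psd (a \o a) by exact: psd_sq.
have Maa : M (a \o a) by exact: vn_comp.
rewrite tauE //; congr (_%:C); apply/le_anti; rewrite (nf_ge0 nf_tr) // andbT.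
apply: le_trans (_ : tr (k%:C *: a) <= 0).
  apply: (nf_le nf_tr) => //; first exact: vnZ.
  exact: psdZ (ltW k0) pa.
by rewrite (nf_scale nf_tr) ?(ltW k0) // t0 mulr0.
Qed.

(* A noncommutative Hahn decomposition: r = b - a for a maximal a in [0, b] with
   psi a <= phi a, which exists by normality of psi. *)
Lemma exhaustion phi psi b : normal_functional phi -> normal_functional psi ->
  M b -> psd b -> phi b < psi b ->
  exists r, [/\ M r, psd r, op_le r b, r <> 0 &
    forall d (k : R), M d -> psd d -> 0 < k -> op_le d (k%:C *: r) -> phi d <= psi d].
Proof.
move=> nphi npsi Mb pb hb.
pose P a := [/\ M a, psd a, op_le a b & psi a <= phi a].
have P0 : P 0.
  by split; [exact: vn0 | exact: psd0 | case: pb | rewrite !nf_zero].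
pose le (s t : {a | P a}) := `[< op_le (sval s) (sval t) >].
have [|s t u|s t|A tA|[a [Ma pa ab ha]] amax] := @Zorn _ le.
- by move=> t; apply/asboolP.
- by move=> /asboolP st /asboolP tu; apply/asboolP; exact: op_le_trans st tu.
- move: s t => [s Ps] [t Pt] /asboolP st /asboolP ts; apply: eq_exist.
  by have [_ ps _ _] := Ps; have [_ pt _ _] := Pt; exact: psd_eq.
- have [[s0 As0]|A0] := pselect (A !=set0); last first.
    by exists (exist _ 0 P0) => s As; case: A0; exists s.
  have [||c [s As <-]|T DT Tb] := @chain_sup_exists _ _ M vM [set sval s | s in A] b _ _ _ pb.
  + by exists (sval s0), s0.
  + move=> _ _ [s As <-] [t At <-].
    by have [/asboolP|/asboolP] := tA _ _ As At; [left | right].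
  + by have [Ms ps sb _] := svalP s.
  have [MT pT] := sup_mem DT.
  (* By normality psi T is reached up to [e] inside the chain, where it is bounded by phi, which is
     monotone. *)
  have PT : P T.
    split=> //; apply/ler_addgt0Pr => e e0; have [_ [s As <-] h] := nf_normal npsi DT e0.
    have [Ms ps sb hs] := svalP s.
    have := nf_le nphi Ms ps MT pT (sup_ub DT (ex_intro2 _ _ s As erefl)).
    by move: hs h; lra.
  exists (exist _ T PT) => s As; apply/asboolP; apply: (sup_ub DT).
  by exists s.
exists (b - a); have Mr := vnB vM Mb Ma; have pr := psdB pa pb ab.
(* If psi d < phi d, then [a + d] would again satisfy [P], and maximality of [a] would give d =
   0. *)
have key d : M d -> psd d -> op_le d (b - a) -> phi d <= psi d.
  move=> Md pd dr; rewrite leNgt; apply/negP => hd.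
  have Mad := vnD vM Ma Md; have pad := psdD pa pd.
  have Pad : P (a + d).
    split=> //.
      move=> u; have := dr u; rewrite ?fctE dotBl dotDl.
      by rewrite lerBrDl.
    by rewrite (nf_add npsi) // (nf_add nphi) //; lra.
  have le_ad : le (exist _ a (And4 Ma pa ab ha)) (exist _ (a + d) Pad).
    by apply/asboolP => u /=; rewrite ?fctE dotDl lerDl psdE // ler0c rq_ge0.
  have /= adE := congr1 sval (amax _ le_ad).
  have d0 : d = 0 by apply: (addrI a); rewrite adE addr0.
  by move: hd; rewrite d0 !nf_zero // ltxx.
split=> //.
- by move=> u; rewrite ?fctE dotBl gerBl psdE // ler0c rq_ge0.
- by move/eqP; rewrite subr_eq0 => /eqP ba; have := ha; rewrite -ba leNgt hb.
move=> d k Md pd k0 dk; have k1 : 0 <= k^-1 by rewrite invr_ge0 ltW.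
have := key (k^-1%:C *: d) (vnZ vM _ Md) (psdZ k1 pd).
rewrite (nf_scale nphi) // (nf_scale npsi) // ler_pM2l ?invr_gt0 //; apply.
move=> u; have := dk u; rewrite ?fctE !dotZl => h.
have kC : 0 < k%:C by rewrite ltcR.
by rewrite fmorphV mulrC ler_pdivrMr // mulrC.
Qed.

End Trace.

(** * The left regular representation *)

Section DenseForms.
Context {R : realType} {H : hilbertType R} (D : set H).
Hypothesis dD : dense_nm D.

Lemma dense_orth (v : H) : (forall u, D u -> '[u, v] = 0) -> v = 0.
Proof.
move=> h; apply: nm_eq0; apply/le_anti; rewrite nm_ge0 andbT.
apply/ler_addgt0Pr => e e0; rewrite add0r.
have [u Du hu] := dD v e0; have := Re_dot_le (v - u) v.
rewrite dotBl (h _ Du) subr0 nm2E ger0_norm ?sqr_ge0 // => hv.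
rewrite leNgt; apply/negP => ev; move: hv; have := nm_ge0 v; nra.
Qed.

Lemma dense_rq (T : H -> H) : blin T -> (forall u, D u -> 0 <= rq T u) ->
  forall u, 0 <= rq T u.
Proof.
move=> bT h u; rewrite leNgt; apply/negP => neg.
have [C C0 hC] := blin_bound bT.
(* Within distance 1 of [u], the form [rq T] changes by at most K - 1 times the distance; the extra
   1 leaves a strictly negative value at [v]. *)
pose K := C * (2 * nm u + 1) + 1; have n0 := nm_ge0 u.
have K1 : 1 <= K by rewrite lerDr mulr_ge0 ?ltW //; lra.
pose e := Num.min 1 (- rq T u / K).
have e0 : 0 < e by rewrite lt_min ltr01 divr_gt0 //; lra.
have e1 : e <= 1 by rewrite ge_min lexx.
have eK : e * K <= - rq T u by rewrite -ler_pdivlMr ?ge_min ?lexx ?orbT //; lra.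
have [v Dv uv] := dD u e0; have := h _ Dv.
have -> : rq T v = rq T u - (Re '[T (u - v), u] + Re '[T v, u - v]).
  rewrite /rq (linB _ _ (blin_lin bT)) dotBl dotBr !ReD !ReN; ring.
have := Re_dot_le (T (u - v)) u; have := Re_dot_le (T v) (u - v).
rewrite !ler_norml => /andP[h1 _] /andP[h2 _].
have hv : nm v <= nm u + nm (u - v) by rewrite -{1}[v](subKr u) nmB.
have := hC (u - v); have := hC v; have := nm_ge0 (u - v).
move: h1 h2 hv uv; move: (nm (u - v)) (nm v) (nm (T v)) (nm (T (u - v))) => a b c d.
move=> h1 h2 hv uv a0 hc hd.
have d1 : d * nm u <= C * e * nm u by apply: ler_wpM2r => //; nra.
have c1 : c * a <= C * (nm u + 1) * e.
  have : c <= C * (nm u + 1) by apply: le_trans hc _; apply: ler_wpM2l; lra.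
  have : 0 <= C * (nm u + 1) by apply: mulr_ge0; lra.
  move: (C * (nm u + 1)) => k *; nra.
have : e * K = C * e * nm u + C * (nm u + 1) * e + e by rewrite /K; ring.
lra.
Qed.

End DenseForms.

(** * Left and right multiplications on L^2, and intertwiners into H *)

Section L2.
Context {R : realType} {H : hilbertType R} (M : set (H -> H)) (tau : (H -> H) -> R[i]).
Context {L : hilbertType R} (iota : (H -> H) -> L) (lambda : (H -> H) -> (L -> L)).
Hypothesis vM : von_neumann_algebra M.
Hypothesis ft : faithful_normal_trace M tau.
Hypothesis iL : is_L2 M tau iota lambda.
Implicit Types (a b x y z : H -> H) (u v w : L).

Local Notation Om := (iota idfun).
Local Notation bM := (vn_blin vM).
Local Notation tr := (tr tau).

Lemma iota0 : iota 0 = 0.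
Proof.
have := L2_linear iL 1 (vn0 vM) (vn0 vM); rewrite !scale1r addr0 => h.
by apply: (addrI (iota 0)); rewrite addr0 -h.
Qed.

Lemma iotaZ t x : M x -> iota (t *: x) = t *: iota x.
Proof.
by move=> Mx; rewrite -[t *: x]addr0 (L2_linear iL) ?iota0 ?addr0 //; exact: vn0.
Qed.

Lemma iotaB x y : M x -> M y -> iota (x - y) = iota x - iota y.
Proof. by move=> Mx My; rewrite addrC -scaleN1r (L2_linear iL) // scaleN1r addrC. Qed.

Lemma iota_dense : dense_nm (iota @` M).
Proof. by move=> u; apply/closure_nm; rewrite (L2_dense iL). Qed.

Lemma iota_nm2 x : M x -> nm (iota x) ^+ 2 = tr (adj x \o x).
Proof. by move=> Mx; rewrite -nm2E (L2_dot iL). Qed.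

Lemma iota_inj x : M x -> iota x = 0 -> x = 0.
Proof.
move=> Mx x0; apply: (trace_faithful ft) => //.
by rewrite -(L2_dot iL) // x0 dot0l.
Qed.

Lemma lam_blin x : M x -> blin (lambda x).
Proof. by move=> /(L2_bounded iL); rewrite bounded_opE. Qed.

Lemma iota_eq (T S : L -> L) : blin T -> blin S ->
  (forall x, M x -> T (iota x) = S (iota x)) -> T = S.
Proof.
by move=> bT bS h; apply: dense_eq bT bS iota_dense _ => _ [x Mx <-]; exact: h.
Qed.

Lemma lam_comp x y : M x -> M y -> lambda (x \o y) = lambda x \o lambda y.
Proof.
move=> Mx My; have Mxy := vn_comp vM Mx My; apply: iota_eq.
- exact: lam_blin.
- by apply: blin_comp; exact: lam_blin.
by move=> z Mz; rewrite /= !(L2_left_mul iL) //; exact: vn_comp.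
Qed.

Lemma lam_linear t x y : M x -> M y -> lambda (t *: x + y) = t *: lambda x + lambda y.
Proof.
move=> Mx My; have Mxy := vn_linear vM t Mx My; apply: iota_eq.
- exact: lam_blin.
- by apply: blin_linear; exact: lam_blin.
move=> z Mz; rewrite ?fctE !(L2_left_mul iL) // -(L2_linear iL) //; exact: vn_comp.
Qed.

Lemma lamD x y : M x -> M y -> lambda (x + y) = lambda x + lambda y.
Proof. by move=> Mx My; rewrite -[x]scale1r lam_linear // !scale1r. Qed.

Lemma lam0 : lambda 0 = 0.
Proof. by have M0 := vn0 vM; apply: (addrI (lambda 0)); rewrite -lamD // !addr0. Qed.

Lemma lamZ t x : M x -> lambda (t *: x) = t *: lambda x.
Proof.
by move=> Mx; rewrite -[t *: x]addr0 lam_linear ?lam0 ?addr0 //; exact: vn0.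
Qed.

Lemma lam_id : lambda idfun = idfun.
Proof.
have Mi := vn_id vM; apply: iota_eq; [exact: lam_blin | exact: blin_id|].
by move=> z Mz; rewrite (L2_left_mul iL).
Qed.

Lemma lam_Om x : M x -> lambda x Om = iota x.
Proof. by move=> Mx; rewrite (L2_left_mul iL) //; exact: vn_id. Qed.

Lemma lam_inj x y : M x -> M y -> lambda x = lambda y -> x = y.
Proof.
move=> Mx My e; apply/eqP; rewrite -subr_eq0; apply/eqP/iota_inj; first exact: vnB.
by rewrite iotaB // -(lam_Om Mx) -(lam_Om My) e subrr.
Qed.

Lemma iota_dot_eq v w : (forall x, M x -> '[iota x, v] = '[iota x, w]) -> v = w.
Proof.
move=> h; apply/eqP; rewrite -subr_eq0; apply/eqP.
by apply: (dense_orth iota_dense) => _ [x Mx <-]; rewrite dotBr (h _ Mx) subrr.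
Qed.

Lemma lam_adj x : M x -> adj (lambda x) = lambda (adj x).
Proof.
move=> Mx; have Mx' := vn_adj vM Mx; have bl := lam_blin Mx.
apply: iota_eq; [exact: adj_blin | exact: lam_blin|].
move=> z Mz; apply: iota_dot_eq => y My; rewrite -adjP // !(L2_left_mul iL) //.
rewrite !(L2_dot iL) //; try exact: vn_comp.
by rewrite adj_comp ?adjK //; exact: bM.
Qed.

Lemma lam_psd a : M a -> psd a -> psd (lambda a).
Proof.
move=> Ma pa; have bl := lam_blin Ma; apply: psdP => //; first by rewrite lam_adj // psd_adj.
apply: (dense_rq iota_dense) => // _ [x Mx <-].
have Max := vn_comp vM Ma Mx.
rewrite /rq (L2_left_mul iL) // (L2_dot iL) //.
have pax := psd_conj pa (bM Mx).
have Mxax : M (adj x \o (a \o x)) by apply: vn_comp => //; exact: vn_adj.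
exact: (nf_ge0 (nf_tr vM ft)).
Qed.

(** The trace property turns |x y|^2 into tau (x y adj y adj x), which is at most the squared bound
    of adj y times tau (x adj x), and this last trace is |x|^2. *)
Lemma rmul_exists y : M y ->
  exists2 T : L -> L, blin T & forall x, M x -> T (iota x) = iota (x \o y).
Proof.
move=> My; have bY := bM My; have My' := vn_adj vM My.
have [C C0 hC] := blin_bound (adj_blin bY).
pose G u v := exists x, [/\ M x, u = iota x & v = iota (x \o y)].
have [|||T bT hT] := @extension R L L G C (ltW C0).
- move=> a _ _ _ _ [x [Mx -> ->]] [z [Mz -> ->]].
  exists (a *: x + z); split; first exact: vn_linear.
    by rewrite (L2_linear iL).
  by rewrite -(L2_linear iL) //; exact: vn_comp.
- move=> _ _ [x [Mx -> ->]]; have Mx' := vn_adj vM Mx; have bX := bM Mx.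
  rewrite -ler_sqr ?nnegrE ?mulr_ge0 ?nm_ge0 ?(ltW C0) // exprMn !iota_nm2 //; last exact: vn_comp.
  have Mxy := vn_comp vM Mx My; have Mxy' := vn_comp vM My' Mx'.
  have -> : tr (adj (x \o y) \o (x \o y)) = tr ((x \o y) \o (adj y \o adj x)).
    by rewrite adj_comp // (tr_comm ft Mxy' Mxy).
  rewrite (tr_comm ft Mx' Mx).
  rewrite -(nf_scale (nf_tr vM ft)) ?sqr_ge0 //; first last.
  + by have := psd_adjM (adj_blin bX); rewrite adjK.
  + exact: vn_comp.
  apply: (nf_le vM (nf_tr vM ft)).
  + exact: vn_comp.
  + have := psd_adjM (blin_comp (adj_blin bY) (adj_blin bX)).
    by rewrite adj_comp ?adjK //; exact: adj_blin.
  + by apply: vnZ => //; exact: vn_comp.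
  + apply: psdZ; first exact: sqr_ge0.
    by have := psd_adjM (adj_blin bX); rewrite adjK.
  move=> u; rewrite ?fctE dotZl /= !(adjP bX) (adjP bY) !dotE -rmorphM lecR -exprMn.
  by rewrite lerXn2r ?nnegrE ?mulr_ge0 ?nm_ge0 ?(ltW C0).
- move=> u e e0; have [_ [x Mx <-] h] := iota_dense u e0.
  by exists (iota x), (iota (x \o y)); split=> //; exists x.
by exists T => // x Mx; apply: hT; exists x.
Qed.

Definition rmul y : L -> L :=
  xget 0 [set T | blin T /\ forall x, M x -> T (iota x) = iota (x \o y)].

Lemma rmulP y : M y -> blin (rmul y) /\ forall x, M x -> rmul y (iota x) = iota (x \o y).
Proof.
move=> /rmul_exists [T bT hT]; rewrite /rmul; case: xgetP => [T' _ //|/(_ T) []].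
by split.
Qed.

Lemma rmul_blin y : M y -> blin (rmul y).
Proof. by case/rmulP. Qed.

Lemma rmulE x y : M x -> M y -> rmul y (iota x) = iota (x \o y).
Proof. by move=> Mx /rmulP [_]; exact. Qed.

Lemma rmul_commutant y : M y -> commutant (lambda @` M) (rmul y).
Proof.
move=> My; have bR := rmul_blin My; apply: commutantI => // _ u [x Mx <-].
have bl := lam_blin Mx.
have /(congr1 (@^~ u)) // : rmul y \o lambda x = lambda x \o rmul y.
apply: iota_eq; [exact: blin_comp | exact: blin_comp|].
move=> z Mz; have Mxz := vn_comp vM Mx Mz; have Mzy := vn_comp vM Mz My.
by rewrite /= !(L2_left_mul iL, rmulE).
Qed.

Lemma rmul_adj y : M y -> adj (rmul y) = rmul (adj y).
Proof.
move=> My; have My' := vn_adj vM My; have bR := rmul_blin My.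
apply: iota_eq; [exact: adj_blin | exact: rmul_blin|].
move=> z Mz; apply: iota_dot_eq => x Mx; rewrite -adjP // !rmulE //.
have Mxy := vn_comp vM Mx My; have Mzy := vn_comp vM Mz My'.
rewrite !(L2_dot iL) // adj_comp ?adjK //; try exact: bM.
have Mz' := vn_adj vM Mz; have Mzx := vn_comp vM Mz' Mx.
by rewrite -[LHS]/(tau ((adj z \o x) \o y)) (trace_comm ft).
Qed.

(** In standard terms [h] is a bounded vector for [tau], and [V] is the M-module map sending [Om] to
    [h]. *)
Definition intertwiner (h : H) (V : L -> H) :=
  blin V /\ forall x, M x -> V (iota x) = x h.

Lemma intertwinerE h V x u : intertwiner h V -> M x -> V (lambda x u) = x (V u).
Proof.
move=> [bV hV] Mx; have bl := lam_blin Mx; have bx := bM Mx.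
have /(congr1 (@^~ u)) // : V \o lambda x = x \o V.
apply: dense_eq (blin_comp bV bl) (blin_comp bx bV) iota_dense _ => _ [z Mz <-] /=.
by rewrite (L2_left_mul iL) // !hV //; exact: vn_comp.
Qed.

Lemma intertwiner_rmul h V y : intertwiner h V -> M y -> intertwiner (y h) (V \o rmul y).
Proof.
move=> [bV hV] My; split; first by apply: blin_comp => //; exact: rmul_blin.
by move=> x Mx; rewrite /= rmulE // hV //; exact: vn_comp.
Qed.

Lemma intertwiner_commutant h V k : intertwiner h V -> commutant M k ->
  intertwiner (k h) (k \o V).
Proof.
move=> [bV hV] ck; split; first by apply: blin_comp => //; exact: commutant_blin ck.
by move=> x Mx; rewrite /= hV // (vn_commute _ Mx ck).
Qed.

Lemma intertwiner_linear t h h' V V' : intertwiner h V -> intertwiner h' V' ->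
  intertwiner (t *: h + h') (t *: V + V').
Proof.
move=> [bV hV] [bV' hV']; split; first exact: blin_linear.
by move=> x Mx; rewrite ?fctE hV // hV' // (blin_lin (bM Mx)).
Qed.

Lemma intertwiner_exists (C : R) h :
  (forall x, M x -> nm (x h) <= C * nm (iota x)) -> exists V, intertwiner h V.
Proof.
move=> hb.
pose G (u : L) (k : H) := exists x, [/\ M x, u = iota x & k = x h].
have [|||T bT hT] := @extension R L H G `|C| (normr_ge0 _).
- move=> a _ _ _ _ [x [Mx -> ->]] [z [Mz -> ->]].
  exists (a *: x + z); split; [exact: vn_linear | by rewrite (L2_linear iL) | by []].
- move=> _ _ [x [Mx -> ->]]; apply: le_trans (hb _ Mx) _.
  by rewrite ler_wpM2r ?nm_ge0 // ler_norm.
- move=> u e e0; have [_ [x Mx <-] hu] := iota_dense u e0.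
  by exists (iota x), (x h); split=> //; exists x.
by exists T; split=> // x Mx; apply: hT; exists x.
Qed.

Lemma psd_neq0 a : psd a -> a <> 0 -> exists h, 0 < rq a h.
Proof.
move=> pa a0; apply: contrapT => none; apply: a0.
apply: polarization; first exact: blin_lin (psd_blin pa).
move=> u; rewrite psdE //; congr (_%:C); apply/le_anti; rewrite rq_ge0 // andbT.
by rewrite leNgt; apply/negP => h; apply: none; exists u.
Qed.

(* Exhausting three times yields 0 <> r in M, psd, and h in H such that, for d below a
   multiple of r, tau d <= C1 <d w, w>, tau d <= C2 <d h, h> and <d h, h> <= C3 tau d,
   with w the projection of Om onto K.  The last bound gives r h an intertwiner V; as
   V w = 0, the second one yields r w = 0, hence tau (r^2) = 0 by the first. *)
Lemma intertwiners_separate u :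
  (forall h V, intertwiner h V -> V u = 0) -> u = 0.
Proof.
pose K : set L := [set u | forall h V, intertwiner h V -> V u = 0].
suff K0 v : K v -> v = 0 by move=> h; exact: K0.
have cK : closed_subspace K.
  split.
  - by move=> h V [bV _]; exact: lin0 (blin_lin bV).
  - by move=> x y Kx Ky h V iV; rewrite (linD _ _ (blin_lin iV.1)) (Kx _ _ iV) (Ky _ _ iV) addr0.
  - by move=> c x Kx h V iV; rewrite (linZ _ _ (blin_lin iV.1)) (Kx _ _ iV) scaler0.
  move=> x /closure_nm hx h V iV; have [bV _] := iV.
  have [C C0 hC] := blin_bound bV; apply: nm_eq0; apply/le_anti; rewrite nm_ge0 andbT.
  apply/ler_addgt0Pr => e e0; rewrite add0r.
  have [|y Ky xy] := hx (e / C); first by rewrite divr_gt0.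
  have -> : V x = V (x - y) by rewrite (linB _ _ (blin_lin bV)) (Ky _ _ iV) subr0.
  by apply: le_trans (hC _) _; rewrite mulrC -ler_pdivlMr // ltW.
have [P [bP KP oP sP fP]] := proj_exists cK.
have Klam x v0 : M x -> K v0 -> K (lambda x v0).
  move=> Mx Kv h V iV; rewrite (intertwinerE _ iV) // (Kv _ _ iV).
  exact: lin0 (blin_lin (bM Mx)).
have Krmul x v0 : M x -> K v0 -> K (rmul x v0).
  by move=> Mx Kv h V iV; exact: Kv (intertwiner_rmul iV Mx).
(* [K] is stable under left and right multiplications and their adjoints, so [P] commutes with both.
   Consequently the left and the right action of [a] agree on P Om: both give P (iota a). *)
have Plam x v0 : M x -> P (lambda x v0) = lambda x (P v0).
  move=> Mx; apply: (proj_comm cK KP oP) => [|w|w]; first exact: lam_blin.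
    exact: Klam.
  by rewrite lam_adj //; apply: Klam; exact: vn_adj.
have Prmul x v0 : M x -> P (rmul x v0) = rmul x (P v0).
  move=> Mx; apply: (proj_comm cK KP oP) => [|w|w]; first exact: rmul_blin.
    exact: Krmul.
  by rewrite rmul_adj //; apply: Krmul; exact: vn_adj.
pose w := P Om; have Mi := vn_id vM.
suff w0 : w = 0.
  have P0 : P = 0.
    apply: iota_eq => //; first exact: blin0.
    move=> x Mx; rewrite -(lam_Om Mx) Plam // -/w w0.
    exact: lin0 (blin_lin (lam_blin Mx)).
  by move=> /fP <-; rewrite P0.
apply: contrapT => wn0.
pose phi a := rq (lambda a) w.
have trE a : M a -> tr a = rq (lambda a) Om.
  by move=> Ma; rewrite /rq lam_Om // (L2_dot iL) // adj_id.
have nphi : normal_functional M phi.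
  apply: (nf_dominated vM _ _ _ (nf_tr vM ft)).
  - by move=> a b Ma pa Mb pb; rewrite /phi lamD // rqD.
  - by move=> t a t0 Ma pa; rewrite /phi lamZ // rqZ.
  (* [Om] splits as w + (Om - w), and [lambda a] preserves [K], so the parts are orthogonal for the
     form of [lambda a]. Its value at [w] is thus at most its value tr a at [Om]. *)
  - move=> a Ma pa; have pl := lam_psd Ma pa; rewrite rq_ge0 //= trE //.
    have Kw : K (lambda a w) by apply: Klam => //; exact: KP.
    have ow : '[Om - w, lambda a w] = 0 := oP Om _ Kw.
    have cross v0 : '[v0, lambda a w] = 0 ->
        rq (lambda a) (v0 + w) = rq (lambda a) w + rq (lambda a) v0.
      move=> v0w; have wv0 : '[lambda a w, v0] = 0 by rewrite dotC v0w conjC0.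
      rewrite /rq (linD _ _ (blin_lin (psd_blin pl))) dotDl !dotDr wv0.
      by rewrite (adjP (psd_blin pl) v0 w) (psd_adj pl) v0w addr0 add0r ReD addrC.
    rewrite -[Om](subrK w) cross //.
    by rewrite lerDl rq_ge0.
have phi_gt0 : 0 < phi idfun.
  rewrite /phi /rq lam_id nm2E exprn_gt0 // lt_def nm_ge0 andbT.
  by apply/eqP => h; apply: wn0; exact: nm_eq0.
have large (x y : R) : 0 < y -> exists2 C : R, 0 < C & x < C * y.
  move=> y0; exists ((`|x| + 1) / y); first by rewrite divr_gt0 // ltr_wpDl.
  rewrite divfK ?lt0r_neq0 //; apply: le_lt_trans (ler_norm x) _.
  by rewrite ltrDl.
(* Each constant is just large enough to start an exhaustion. Each new element lies below the
   previous one, so the earlier comparisons persist. *)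
have [C1 C10 hC1] := large (tr idfun) _ phi_gt0.
have [r1 [Mr1 pr1 _ nz1 hr1]] := exhaustion vM (nf_tr vM ft) (nf_mul (ltW C10) nphi) Mi psd_id hC1.
have [h hh] := psd_neq0 pr1 nz1.
have [C2 C20 hC2] := large (tr r1) _ hh.
have [r2 [Mr2 pr2 r21 nz2 hr2]] :=
  exhaustion vM (nf_tr vM ft) (nf_mul (ltW C20) (nf_vector M h)) Mr1 pr1 hC2.
have tr2 : 0 < tr r2.
  rewrite lt_def (nf_ge0 (nf_tr vM ft)) // andbT; apply/eqP => t0.
  by apply: nz2; exact: (tr_eq0 vM ft).
have [C3 C30 hC3] := large (rq r2 h) _ tr2.
have [r [Mr pr r32 nz hr3]] :=
  exhaustion vM (nf_vector M h) (nf_mul (ltW C30) (nf_tr vM ft)) Mr2 pr2 hC3.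
have scale_le (k : R) (a b : H -> H) : 0 < k -> op_le a b -> op_le (k%:C *: a) (k%:C *: b).
  by move=> k0 ab z; rewrite ?fctE !dotZl ler_wpM2l // ?ler0c ?ltW.
have tr_sandwich x : M x -> tr (r \o adj x \o x \o r) = nm (rmul r (iota x)) ^+ 2.
  move=> Mx; have Mxr := vn_comp vM Mx Mr.
  by rewrite rmulE // iota_nm2 // adj_comp ?(psd_adj pr) //; exact: bM.
have rq_sandwich x : M x -> rq (r \o adj x \o x \o r) h = nm (x (r h)) ^+ 2.
  move=> Mx; rewrite /rq /= -{1}(psd_adj pr) adjPr; last exact: psd_blin.
  by rewrite adjPr ?nm2E //; exact: bM.
(* On r adj (x) x r the third comparison reads |x (r h)|^2 <= C3 |x r|^2, and right multiplication
   by [r] is bounded. *)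
have [V iV] : exists V, intertwiner (r h) V.
  have [C C0 hC] := blin_bound (rmul_blin Mr).
  apply: (@intertwiner_exists (Num.sqrt C3 * C)) => x Mx.
  rewrite -ler_sqr ?nnegrE ?mulr_ge0 ?nm_ge0 ?sqrtr_ge0 ?(ltW C0) // -rq_sandwich //.
  have [k k0 hk] := op_le_sandwich pr (bM Mx).
  apply: le_trans (hr3 _ k (vn_sandwich vM Mr Mx) (psd_sandwich pr (bM Mx)) k0 hk) _.
  rewrite tr_sandwich // -mulrA exprMn sqr_sqrtr ?(ltW C30) // ler_wpM2l ?(ltW C30) //.
  by rewrite lerXn2r ?nnegrE ?mulr_ge0 ?nm_ge0 ?(ltW C0).
(* The second comparison on the same elements: |x r|^2 <= C2 |x (r h)|^2, extended from M to L^2 by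
   density. *)
have VR v0 : nm (rmul r v0) <= Num.sqrt C2 * nm (V v0).
  apply: (dense_le (rmul_blin Mr) iV.1 (sqrtr_ge0 _) iota_dense) => _ [x Mx <-].
  rewrite -ler_sqr ?nnegrE ?mulr_ge0 ?nm_ge0 ?sqrtr_ge0 // -tr_sandwich //.
  rewrite exprMn sqr_sqrtr ?(ltW C20) // (iV.2 _ Mx) -rq_sandwich //.
  have [k k0 hk] := op_le_sandwich pr (bM Mx).
  apply: (hr2 _ k (vn_sandwich vM Mr Mx) (psd_sandwich pr (bM Mx)) k0).
  exact: op_le_trans hk (scale_le _ _ _ k0 r32).
(* The left action of [r] on [w] is traded for the right one, which is controlled by [V]; and [V]
   kills [w], a vector of [K]. *)
have lrw : lambda r w = 0.
  rewrite -Plam // lam_Om // -[r]/(idfun \o r) -rmulE // Prmul // -/w.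
  apply: nm_eq0; apply/le_anti; rewrite nm_ge0 andbT.
  by apply: le_trans (VR _) _; rewrite (KP Om _ _ iV) nm0 mulr0.
apply: nz; apply: (trace_faithful ft) => //; rewrite (psd_adj pr).
have Mrr := vn_comp vM Mr Mr; have prr := psd_sq pr.
rewrite (tauE ft) //; congr (_%:C); apply/le_anti.
rewrite (nf_ge0 (nf_tr vM ft)) // andbT.
have [k k0] := op_le_sandwich pr (@blin_id _ H); rewrite adj_id => hk.
apply: le_trans (hr1 _ k Mrr prr k0 _) _.
  apply: op_le_trans hk _; apply: op_le_trans (scale_le _ _ _ k0 r32) _.
  exact: scale_le.
rewrite /phi lam_comp // /rq /= lrw (lin0 (blin_lin (lam_blin Mr))) dot0l.
by rewrite mulr0.
Qed.

End L2.

(** * The bicommutant on L^2(M, tau) *)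

Section Closure.
Context {R : realType} {H : hilbertType R} (S : set H).

Lemma closure_subspace : S 0 -> (forall a x y, S x -> S y -> S (a *: x + y)) ->
  closed_subspace (closure S).
Proof.
move=> S0 Slin.
have cS x : S x -> closure S x by move=> Sx; exact: subset_closure.
have lin a x y : closure S x -> closure S y -> closure S (a *: x + y).
  move=> /closure_nm hx /closure_nm hy; apply/closure_nm => e e0.
  have a0 : 0 <= Re `|a| by have := normr_ge0 a; rewrite lecE => /andP[].
  have e1 : 0 < e / (Re `|a| + 1) by rewrite divr_gt0 // ltr_wpDl.
  have [x' Sx' hx'] := hx _ e1; have [y' Sy' hy'] := hy _ e1.
  exists (a *: x' + y'); first exact: Slin.
  rewrite opprD addrACA -scalerBr; apply: le_lt_trans (nmD _ _) _; rewrite nmZ.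
  have h : Re `|a| * nm (x - x') <= Re `|a| * (e / (Re `|a| + 1)).
    by rewrite ler_wpM2l // ltW.
  have -> : e = Re `|a| * (e / (Re `|a| + 1)) + e / (Re `|a| + 1).
    by field; apply: lt0r_neq0; rewrite ltr_wpDl.
  lra.
split; first exact: cS.
- by move=> x y cx cy; rewrite -[x]scale1r; exact: lin.
- by move=> a x cx; rewrite -[_ *: _]addr0; apply: lin => //; exact: cS.
exact: closed_closure.
Qed.

Lemma closure_stable (T : H -> H) : blin T -> (forall x, S x -> S (T x)) ->
  forall x, closure S x -> closure S (T x).
Proof.
move=> bT ST x /closure_nm hx; apply/closure_nm => e e0.
have [C C0 hC] := blin_bound bT.
have [|y Sy xy] := hx (e / C); first by rewrite divr_gt0.
exists (T y); first exact: ST.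
rewrite -(linB _ _ (blin_lin bT)); apply: le_lt_trans (hC _) _.
by rewrite mulrC -ltr_pdivlMr.
Qed.

End Closure.

(** By log-convexity the ratios p_(n+1) / p_n do not decrease, so p_n >= t^n p_0 with t = p_1 / p_0.
    If t > c, Bernoulli's inequality contradicts the bound K c^n. The point is that [K] disappears
    from the conclusion. *)
Lemma log_convex_bound (R : realType) (p : nat -> R) (K c : R) : 0 < c ->
  (forall n, 0 <= p n) -> (forall n, p n.+1 ^+ 2 <= p n * p n.+2) ->
  (forall n, p n <= K * c ^+ n) -> p 1%N <= c * p 0%N.
Proof.
move=> c0 pos conv bnd; rewrite leNgt; apply/negP => hlt.
have [p0|p0] := eqVneq (p 0%N) 0.
  have := conv 0%N; rewrite p0 mul0r => h.
  by move: hlt; rewrite p0 mulr0 => h1; have : 0 < p 1%N ^+ 2; [rewrite exprn_gt0|lra].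
have {}p0 : 0 < p 0%N by rewrite lt_def p0 pos.
pose t := p 1%N / p 0%N; have p1E : p 1%N = t * p 0%N by rewrite divfK ?gt_eqF.
have tc : c < t by rewrite ltr_pdivlMr.
have t0 : 0 < t by exact: lt_trans tc.
have step n : 0 < p n /\ t * p n <= p n.+1.
  elim: n => [|n [pn IH]]; first by rewrite p1E.
  have pS : 0 < p n.+1 by apply: lt_le_trans IH; rewrite mulr_gt0.
  split=> //; rewrite -(ler_pM2l pn); apply: le_trans (conv n).
  by rewrite mulrA (mulrC (p n)) expr2 ler_wpM2r // ltW.
have geo n : t ^+ n * p 0%N <= p n.
  elim: n => [|n IH]; first by rewrite mul1r.
  have [_ hn] := step n; apply: le_trans hn.
  by rewrite exprS -mulrA ler_wpM2l // ltW.
pose s := t / c - 1; have s0 : 0 < s by rewrite subr_gt0 ltr_pdivlMr ?mul1r.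
have tE : t = (1 + s) * c by rewrite /s addrC subrK divfK // gt_eqF.
have bern n : 1 + n%:R * s <= (1 + s) ^+ n.
  elim: n => [|n IH]; first by rewrite mul0r addr0.
  rewrite exprS -natr1; apply: le_trans (_ : (1 + s) * (1 + n%:R * s) <= _).
    have : 0 <= n%:R * s * s by rewrite !mulr_ge0 // ltW.
    by move: (n%:R : R) => m; nra.
  by rewrite ler_wpM2l //; lra.
have fin n : n%:R * (s * p 0%N) <= K.
  have cn : 0 < c ^+ n by rewrite exprn_gt0.
  rewrite -(ler_pM2r cn); apply: le_trans (bnd n); apply: le_trans (geo n).
  rewrite tE exprMn mulrA [X in X <= _]mulrAC ler_wpM2r ?(ltW p0) // ler_wpM2r ?(ltW cn) //.
  by apply: le_trans (bern n); rewrite lerDr.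
have sp : 0 < s * p 0%N by rewrite mulr_gt0.
have [n] : exists n : nat, K / (s * p 0%N) < n%:R.
  exists (Num.bound `|K / (s * p 0%N)|).
  exact: le_lt_trans (ler_norm _) (archi_boundP (normr_ge0 _)).
by rewrite ltr_pdivrMr // ltNge fin.
Qed.

Section Bicommutant.
Context {R : realType} {H : hilbertType R} (M : set (H -> H)) (tau : (H -> H) -> R[i]).
Context {L : hilbertType R} (iota : (H -> H) -> L) (lambda : (H -> H) -> (L -> L)).
Hypothesis vM : von_neumann_algebra M.
Hypothesis ft : faithful_normal_trace M tau.
Hypothesis iL : is_L2 M tau iota lambda.

Local Notation Om := (iota idfun).
Local Notation intertwiner := (intertwiner M iota).

(** The projection [P] onto the closure lies in M, because the commutant of M preserves the set of
    such vectors. Then 1 - P kills each of them, so every intertwiner kills iota (1 - P), and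
    separation gives P = 1. *)
Lemma intertwiner_dense : dense_nm [set h | exists V, intertwiner h V].
Proof.
set H0 := [set h | _].
have cW : closed_subspace (closure H0).
  apply: closure_subspace => [|a x y [V iV] [V' iV']].
    exists 0; split; first exact: blin0.
    by move=> x Mx; rewrite (lin0 (blin_lin (vn_blin vM Mx))).
  by exists (a *: V + V'); exact: intertwiner_linear.
have [P [bP WP oP sP fP]] := proj_exists cW.
have MP : M P.
  apply: (vn_mem vM) => // S x cS; have bS := commutant_blin cS.
  apply: (proj_comm cW WP oP) => //; apply: closure_stable => //.
  - by move=> h [V iV]; exists (S \o V); exact: intertwiner_commutant.
  - exact: adj_blin.
  - move=> h [V iV]; exists (adj S \o V); apply: intertwiner_commutant => //.
    exact: vn_commutant_adj.
have Mz := vnB vM (vn_id vM) MP.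
have z0 : idfun - P = 0.
  apply: (iota_inj ft iL Mz); apply: (intertwiners_separate vM ft iL).
  move=> h V iV; rewrite (iV.2 _ Mz) ?fctE fP ?subrr //.
  by apply: subset_closure; exists V.
move=> x; apply/closure_nm.
have -> : x = P x.
  by apply/eqP; rewrite -subr_eq0; apply/eqP; exact: (congr1 (@^~ x) z0).
exact: WP.
Qed.

Local Notation lamM := (lambda @` M).

Lemma lamM_blin T : lamM T -> blin T.
Proof. by move=> [x Mx <-]; exact: (lam_blin iL Mx). Qed.

Lemma lamM_adj T : lamM T -> lamM (adj T).
Proof. by move=> [x Mx <-]; exists (adj x); [exact: vn_adj | rewrite (lam_adj vM iL)]. Qed.

(* With S = adj V \o V, which commutes with a = adj q \o q, the numbers
   p_n = |V a^n Om| satisfy p_(n+1)^2 <= p_n p_(n+2). *)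
Lemma bicommutant_bound q : commutant (commutant lamM) q ->
  exists2 C : R, 0 <= C & forall h V, intertwiner h V -> nm (V (q Om)) <= C * nm h.
Proof.
move=> cq; have bq := commutant_blin cq; have bq' := adj_blin bq.
pose a := adj q \o q; have ba : blin a by exact: blin_comp.
have [c c0 hc] := blin_bound ba.
(* The constant must not depend on [V], whose norm is not controlled by |h|. It arises from |V (q
   Om)|^2 <= p_1 p_0 <= c |h|^2. *)
exists (Num.sqrt c); first exact: sqrtr_ge0.
move=> h V iV; have [bV hV] := iV.
have hE : V Om = h by rewrite hV //; exact: vn_id.
have [Vs bVs hVs] := adjoint_exists bV.
pose S := Vs \o V; have bS : blin S by exact: blin_comp.
have SP u v : '[V u, V v] = '[u, S v] by rewrite hVs.
(* As [V] intertwines the two actions of M, [S] commutes with left multiplications; hence [q] and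
   its adjoint, being in the bicommutant, commute with [S]. *)
have cS : commutant lamM S.
  apply: commutantI => // _ u [x Mx <-]; apply: dot_eq => v.
  rewrite -SP (intertwinerE vM iL _ iV Mx) -(adjPr (vn_blin vM Mx)).
  have Mx' := vn_adj vM Mx; have bl := lam_blin iL Mx.
  by rewrite -(intertwinerE vM iL _ iV Mx') SP -(lam_adj vM iL Mx) adjPr.
have qS u : q (S u) = S (q u) by exact: commutant_comm cq cS.
have q'S u : adj q (S u) = S (adj q u).
  have cq' : commutant (commutant lamM) (adj q).
    apply: commutant_adj cq; first exact: commutant_blin.
    by move=> T; apply: commutant_adj; [exact: lamM_blin | exact: lamM_adj].
  exact: commutant_comm cq' cS.
have aS u : a (S u) = S (a u) by rewrite /a /= qS q'S.
have aV u v : '[V (a u), V v] = '[V u, V (a v)].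
  by rewrite !SP -aS /a /= (adjPr bq) (adjP bq).
pose p n := nm (V (iter n a Om)).
have [C C0 hC] := blin_bound bV.
have pb n : p n <= (C * nm Om) * c ^+ n.
  rewrite -mulrA; apply: le_trans (hC _) _; rewrite ler_wpM2l ?(ltW C0) //.
  elim: n => [|n IH]; first by rewrite mulr1.
  by rewrite iterS; apply: le_trans (hc _) _; rewrite exprS mulrCA ler_wpM2l ?(ltW c0).
have pconv n : p n.+1 ^+ 2 <= p n * p n.+2.
  rewrite -nm2E /p !iterS aV; apply: le_trans (ler_norm _) _; exact: Re_dot_le.
have := log_convex_bound c0 (fun n => nm_ge0 _) pconv pb; rewrite /p /= hE => p1.
rewrite -ler_sqr ?nnegrE ?mulr_ge0 ?nm_ge0 ?sqrtr_ge0 // exprMn sqr_sqrtr ?(ltW c0) //.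
have -> : nm (V (q Om)) ^+ 2 = Re '[V (a Om), V Om].
  by rewrite -nm2E !SP -qS -(adjPr bq).
apply: le_trans (ler_norm _) _; apply: le_trans (Re_dot_le _ _) _.
by rewrite hE expr2 mulrA ler_wpM2r // nm_ge0.
Qed.

(** If [q] is [lambda x], then V (q Om) = x h. This formula is taken as the definition of [x] on the
    dense set of vectors [h] with an intertwiner [V]; the uniform bound makes it consistent and
    bounded. *)
Theorem bicommutant_lam q : commutant (commutant lamM) q -> exists2 x, M x & q = lambda x.
Proof.
move=> cq; have bq := commutant_blin cq; have [C C0 hC] := bicommutant_bound cq.
pose G (h k : H) := exists V, intertwiner h V /\ k = V (q Om).
have [||| x bx hx] := @extension R H H G C C0.
- move=> t h h' _ _ [V [iV ->]] [V' [iV' ->]]; exists (t *: V + V'); split=> //.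
  exact: intertwiner_linear.
- by move=> h _ [V [iV ->]]; exact: hC.
- move=> h e e0; have [h' [V iV] hh'] := intertwiner_dense h e0.
  by exists h', (V (q Om)); split=> //; exists V.
have xE h V : intertwiner h V -> x h = V (q Om) by move=> iV; apply: hx; exists V.
have Mx : M x.
  apply: (vn_mem vM) => // S u cS; have bS := commutant_blin cS.
  have /(congr1 (@^~ u)) // : x \o S = S \o x.
  apply: dense_eq intertwiner_dense _; [exact: blin_comp | exact: blin_comp|].
  move=> h [V iV] /=; rewrite (xE _ _ iV).
  by rewrite (xE _ _ (intertwiner_commutant iV cS)).
exists x => //; have bl := lam_blin iL Mx; apply: (iota_eq iL) => // y My.
apply/eqP; rewrite -subr_eq0; apply/eqP; apply: (intertwiners_separate vM ft iL).
move=> h V iV; have [bV hV] := iV; have Mxy := vn_comp vM Mx My.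
rewrite (linB _ _ (blin_lin bV)) (L2_left_mul iL) // hV //=.
(* [V \o rmul y] is an intertwiner for [y h], and [q] commutes with [rmul y], so x (y h) = V (rmul y
   (q Om)) = V (q (iota y)). *)
rewrite (xE _ _ (intertwiner_rmul vM ft iL iV My)) /=.
rewrite -(commutant_comm _ cq (rmul_commutant vM ft iL My)).
by rewrite (rmulE vM ft iL (vn_id vM) My) subrr.
Qed.

End Bicommutant.

(** * Invariant subspaces of the amplified algebra *)

Section DirectSum.
Context {R : realType} {L : hilbertType R} {I : finType}.
Implicit Types (u v w : I -> L).

Definition dsum u v : R[i] := \sum_i '[u i, v i].

Lemma dsum_linear a u v w : dsum (a *: u + v) w = a * dsum u w + dsum v w.
Proof.
rewrite /dsum mulr_sumr -big_split; apply: eq_bigr => i _.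
by rewrite ?fctE dot_linear.
Qed.

Lemma dsum_conj u v : dsum v u = ((dsum u v)^* )%R.
Proof. by rewrite /dsum rmorph_sum; apply: eq_bigr => i _; rewrite dotC. Qed.

Lemma dsumE u : dsum u u = (\sum_i nm (u i) ^+ 2)%:C.
Proof. by rewrite /dsum rmorph_sum; apply: eq_bigr => i _; rewrite dotE. Qed.

Lemma dsum_pos u : 0 <= dsum u u.
Proof. by apply: sumr_ge0 => i _; exact: dot_ge0. Qed.

Lemma nm2_le_dsum u i : nm (u i) ^+ 2 <= Re (dsum u u).
Proof.
rewrite dsumE /= (bigD1 i) //= lerDl.
by apply: sumr_ge0 => j _; exact: sqr_ge0.
Qed.

Lemma dsum_def u : Re (dsum u u) = 0 -> u = 0.
Proof.
move=> u0; apply/funext => i; apply: nm_eq0; apply/eqP; rewrite -sqrf_eq0.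
by apply/eqP/le_anti; rewrite sqr_ge0 andbT -u0 nm2_le_dsum.
Qed.

Lemma uniform_rank (P : I -> nat -> Prop) :
  (forall i, exists N, forall n, (N <= n)%N -> P i n) ->
  exists N, forall n, (N <= n)%N -> forall i, P i n.
Proof.
move=> /choice [N hN]; exists (\max_i N i) => n Nn i.
by apply: hN; apply: leq_trans Nn; exact: leq_bigmax.
Qed.

Lemma dsum_complete (W : set (I -> L)) :
  (forall w, (forall e : R, 0 < e -> exists2 w', W w' & forall i, nm (w i - w' i) < e) -> W w) ->
  complete_set dsum W.
Proof.
move=> cW u Wu uc.
have sq_lt (x e : R) : 0 <= x -> 0 < e -> x ^+ 2 < e ^+ 2 -> x < e.
  by move=> x0 e0; rewrite ltr_pXn2r // nnegrE // ltW.
have /choice [w hw] i : exists w : L, forall e : R, 0 < e ->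
    exists N, forall n, (N <= n)%N -> nm (u n i - w) < e.
  apply: (hilbert_complete (u := fun n => u n i)) => e e0.
  have [|N HN] := uc (e ^+ 2); first by rewrite exprn_gt0.
  exists N => m n Nm Nn; apply: sq_lt => //; first exact: nm_ge0.
  by apply: le_lt_trans (HN _ _ Nm Nn); exact: (nm2_le_dsum (u m - u n)).
have unif (e : R) : 0 < e -> exists N, forall n, (N <= n)%N -> forall i, nm (u n i - w i) < e.
  by move=> e0; apply: uniform_rank => i; exact: hw.
exists w.
  apply: cW => e /unif [N HN]; exists (u N) => // i; rewrite nmBC.
  exact: HN.
(* One more than the number of summands: the sum of #|I| terms e / K is strictly below [e], and [K]
   is positive even for empty [I]. *)
move=> e e0; pose K : R := #|I|%:R + 1.
have K0 : 0 < K by rewrite ltr_wpDl.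
have [|N HN] := unif (Num.sqrt (e / K)); first by rewrite sqrtr_gt0 divr_gt0.
exists N => n /HN h; rewrite dsumE /=.
apply: le_lt_trans (_ : \sum_(i : I) e / K < _).
  apply: ler_sum => i _; rewrite -[leRHS]sqr_sqrtr; last by rewrite divr_ge0 ?ltW.
  by rewrite lerXn2r ?nnegrE ?nm_ge0 ?sqrtr_ge0 // ltW //; exact: h.
rewrite sumr_const -mulr_natl mulrCA -[ltRHS]mulr1 ltr_pM2l //.
by rewrite ltr_pdivrMr // mul1r ltrDl.
Qed.

Lemma dsum_projection (W : set (I -> L)) :
  W 0 -> (forall a u v, W u -> W v -> W (a *: u + v)) -> complete_set dsum W ->
  exists Q : (I -> L) -> (I -> L), [/\ linear Q, forall u, W (Q u),
    forall u w, W w -> dsum (u - Q u) w = 0, forall u v, dsum (Q u) v = dsum u (Q v) &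
    forall w, W w -> Q w = w].
Proof. exact: (projection_exists dsum_linear dsum_conj dsum_pos dsum_def). Qed.

Lemma dsum_projection_le u v : dsum (u - v) v = 0 -> Re (dsum v v) <= Re (dsum u u).
Proof. exact: (projection_le dsum_linear dsum_conj dsum_pos). Qed.

Lemma dsum_projection_comm (W : set (I -> L)) (Q : (I -> L) -> (I -> L)) (T T' : L -> L) :
  (forall u, W (Q u)) -> (forall u w, W w -> dsum (u - Q u) w = 0) ->
  (forall x y, T (x - y) = T x - T y) -> (forall x y, '[T x, y] = '[x, T' y]) ->
  (forall w, W w -> W (fun i => T (w i))) -> (forall w, W w -> W (fun i => T' (w i))) ->
  (forall u v, W u -> W v -> W (u - v)) ->
  forall u, Q (fun i => T (u i)) = fun i => T (Q u i).
Proof.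
move=> WQ oQ TB TT' WT WT' WB.
apply: (projection_comm dsum_linear dsum_def WQ oQ (T := fun u i => T (u i))
  (T' := fun u i => T' (u i))) WT WT' WB.
  by move=> u v; apply/funext => i; exact: TB.
by move=> u v; apply: eq_bigr => i _; exact: TT'.
Qed.

Definition inj i (x : L) : I -> L := fun j => if j == i then x else 0.

Lemma inj_linear i : linear (inj i).
Proof.
move=> a x y; apply/funext => j; rewrite /inj ?fctE; case: (j == i) => //.
by rewrite scaler0 addr0.
Qed.

Lemma sum_inj u : u = \sum_i inj i (u i).
Proof.
apply/funext => j; rewrite fct_sumE (bigD1 j) //= /inj eqxx big1 ?addr0 // => i.
by rewrite eq_sym => /negPf ->.
Qed.

Lemma dsum_inj i x v : dsum v (inj i x) = '[v i, x].
Proof.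
rewrite /dsum (bigD1 i) //= /inj eqxx big1 ?addr0 // => j /negPf ->.
by rewrite dot0r.
Qed.

End DirectSum.

(** * The algebra generated by Z, N and the commutant of M *)

Section Transitive.
Context {R : realType} {H : hilbertType R} (M : set (H -> H)) (tau : (H -> H) -> R[i]).
Context {L : hilbertType R} (iota : (H -> H) -> L) (lambda : (H -> H) -> (L -> L)).
Variables (N : set (H -> H)) (Z : H -> H).
Hypothesis vM : von_neumann_algebra M.
Hypothesis ft : faithful_normal_trace M tau.
Hypothesis iL : is_L2 M tau iota lambda.
Hypothesis vN : von_neumann_algebra N.
Hypothesis NM : N `<=` M.
Hypothesis MZ : M Z.
Hypothesis Zn0 : Z <> 0.

Local Notation Om := (iota idfun).
Local Notation K := [set X | (commutant N `&` M) X /\ tau X = 0].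
Local Notation lamM := (lambda @` M).
Local Notation gens := ([set lambda Z] `|` lambda @` N `|` commutant lamM).
Local Notation A := (generated_algebra gens).

Hypothesis orthZX : orthogonal_sets [set iota Z] [set iota (Z \o X) | X in K].
Hypothesis orthXZ : orthogonal_sets [set iota Z] [set iota (X \o Z) | X in K].
Hypothesis orthZXXZ :
  orthogonal_sets [set iota (Z \o X) | X in K] [set iota (X \o Z) | X in K].

Lemma gens_bounded : gens `<=` bounded_op.
Proof.
rewrite bounded_opE => T [[->|[x /NM Mx <-]]|].
- exact: (lam_blin iL MZ).
- exact: (lam_blin iL Mx).
- exact: commutant_blin.
Qed.

Lemma A_subalgebra : subalgebra A.
Proof.
have bsub : subalgebra (@bounded_op R L).
  rewrite bounded_opE; split; first (by rewrite bounded_opE); first exact: blin0.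
  - by move=> *; exact: blinD.
  - by move=> *; exact: blinZ.
  - by move=> *; exact: blin_comp.
split.
- by apply: smallest_sub => //; exact: gens_bounded.
- by move=> B [[]].
- by move=> T S AT AS B hB; have [[_ _ h _ _] _] := hB; apply: h; [exact: AT|exact: AS].
- by move=> c T AT B hB; have [[_ _ _ h _] _] := hB; apply: h; exact: AT.
- by move=> T S AT AS B hB; have [[_ _ _ _ h] _] := hB; apply: h; [exact: AT|exact: AS].
Qed.

Lemma A_gens T : gens T -> A T.
Proof. by move=> gT; exact: sub_gen_smallest. Qed.

Lemma A_id : A idfun.
Proof.
by apply: A_gens; right; apply: commutantI; [exact: blin_id | by []].
Qed.

Lemma A_blin T : A T -> blin T.
Proof. by have [+ _ _ _ _] := A_subalgebra; rewrite bounded_opE; exact. Qed.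

Section Amplification.
Variables (I : finType) (W : set (I -> L)).
Hypothesis Wlin : forall a u v, W u -> W v -> W (a *: u + v).
Hypothesis W0 : W 0.
Hypothesis Wclosed : forall w,
  (forall e : R, 0 < e -> exists2 w', W w' & forall i, nm (w i - w' i) < e) -> W w.
Hypothesis Wstable : forall T w, gens T -> W w -> W (fun i => T (w i)).

(** Describing [W] as the fixed points of a scalar matrix is the form needed later: every linear map
    applied coordinatewise respects such relations. *)
Lemma invariant_scalar : exists t : I -> I -> R[i],
  (forall w, W w -> forall i, w i = \sum_j t i j *: w j) /\
  (forall w, (forall i, w i = \sum_j t i j *: w j) -> W w).
Proof.
have [Q [lQ WQ oQ sQ fQ]] := dsum_projection W0 Wlin (dsum_complete Wclosed).
have WB u v : W u -> W v -> W (u - v).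
  by move=> Wu Wv; rewrite addrC -scaleN1r; exact: Wlin.
pose amp (T : L -> L) (u : I -> L) : I -> L := fun i => T (u i).
(* Invariance under the adjoint enters here, which covers N and the commutant; for [Z] only
   invariance itself is available. *)
have comm T u : gens T -> gens (adj T) -> Q (amp T u) = amp T (Q u).
  move=> gT gT'; have bT : blin T by move: (gens_bounded gT); rewrite bounded_opE.
  apply: (dsum_projection_comm WQ oQ _ _ _ _ WB).
  - by move=> y z; exact: linB (blin_lin bT).
  - exact: adjP.
  - by move=> w; exact: Wstable.
  - by move=> w; exact: Wstable.
pose q i j := fun u : L => Q (inj j u) i.
have bq i j : blin (q i j).
  split=> [a u v|]; first by rewrite /q inj_linear lQ.
  exists 1 => u; rewrite mul1r -ler_sqr ?nnegrE ?nm_ge0 //.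
  have Qle := dsum_projection_le (oQ _ _ (WQ (inj j u))).
  apply: le_trans (nm2_le_dsum _ _) (le_trans Qle _).
  by rewrite dsum_inj /inj eqxx nm2E.
have QE v i : Q v i = \sum_j q i j (v j).
  rewrite {1}[v]sum_inj /q.
  have -> : Q (\sum_j inj j (v j)) = \sum_j Q (inj j (v j)).
    apply: (big_ind2 (fun x y => Q x = y)) => //; first exact: lin0.
    by move=> x _ y _ <- <-; exact: linD.
  by rewrite fct_sumE.
have qcomm i j T u : gens T -> gens (adj T) -> q i j (T u) = T (q i j u).
  move=> gT gT'; have bT : blin T by move: (gens_bounded gT); rewrite bounded_opE.
  have e : amp T (inj j u) = inj j (T u).
    apply/funext => k; rewrite /amp /inj; case: (k == j) => //.
    exact: lin0 (blin_lin bT).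
  by rewrite /q -e comm.
have qadj i j : adj (q i j) = q j i.
  by apply: adj_unique => u v; rewrite -!dsum_inj sQ dsum_conj dsum_inj -dotC.
have commgens T : commutant lamM T -> gens T /\ gens (adj T).
  move=> cT; split; right => //; apply: commutant_adj cT.
    exact: (lamM_blin iL).
  exact: (lamM_adj vM iL).
have Ngens y : N y -> gens (lambda y) /\ gens (adj (lambda y)).
  move=> Ny; split; left; right; first by exists y.
  by exists (adj y); [exact: vn_adj | rewrite (lam_adj vM iL) //; exact: NM].
have qx i j : exists2 x, M x & q i j = lambda x.
  apply: (bicommutant_lam vM ft iL); apply: commutantI => // T u /commgens [gT gT'].
  exact: qcomm.
pose x i j := xget 0 [set x | M x /\ q i j = lambda x].
have xP i j : M (x i j) /\ q i j = lambda (x i j).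
  by rewrite /x; case: xgetP => // /= h; have [y My e] := qx i j; case: (h y).
have Mx i j : M (x i j) by case: (xP i j).
have xN i j : commutant N (x i j).
  have [Mxij qE] := xP i j.
  apply: commutantI => [|y h Ny]; first exact: vn_blin Mxij.
  have My := NM Ny; have [g g'] := Ngens _ Ny.
  have /(congr1 (@^~ h)) // : x i j \o y = y \o x i j.
  apply: (lam_inj vM ft iL); [exact: vn_comp | exact: vn_comp|].
  rewrite (lam_comp vM iL Mxij My) (lam_comp vM iL My Mxij) -qE; apply/funext => u /=; exact: qcomm.
have xadj i j : adj (x i j) = x j i.
  apply: (lam_inj vM ft iL) => //; first exact: vn_adj.
  by rewrite -(lam_adj vM iL) // -(xP i j).2 -(xP j i).2.
pose t i j := tau (x i j); pose X i j := x i j - t i j *: idfun.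
have Mi := vn_id vM; have MtI i j : M (t i j *: idfun) by exact: vnZ.
have XK i j : K (X i j).
  split; last first.
    by rewrite (tauB ft) // (tauZ vM ft) // (trace_unit ft) mulr1 subrr.
  split; last exact: vnB.
  have bX : blin (X i j) by apply: (vn_blin vM); exact: vnB.
  apply: commutantI => // y h Ny; have By := vn_blin vN Ny.
  rewrite /X ?fctE (commutant_comm _ (xN i j) Ny) (linB _ _ (blin_lin By)).
  by rewrite (linZ _ _ (blin_lin By)).
have MX i j : M (X i j) by exact: vnB.
have bZ := vn_blin vM MZ.
have ZxE i j : iota (Z \o x i j) = t i j *: iota Z + iota (Z \o X i j).
  rewrite -(L2_linear iL) //; last exact: vn_comp.
  congr iota; apply/funext => h; rewrite /X ?fctE /= (linB _ _ (blin_lin bZ)).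
  by rewrite (linZ _ _ (blin_lin bZ)) addrC subrK.
have xZE i j : iota (x i j \o Z) = t i j *: iota Z + iota (X i j \o Z).
  rewrite -(L2_linear iL) //; last exact: vn_comp.
  by congr iota; apply/funext => h; rewrite /X ?fctE /= addrC subrK.
have o1 i j : '[iota Z, iota (Z \o X i j)] = 0.
  by apply: orthZX => //; exists (X i j).
have o1' i j : '[iota (Z \o X i j), iota Z] = 0 by rewrite dotC o1 conjC0.
have o2 i j : '[iota Z, iota (X i j \o Z)] = 0.
  by apply: orthXZ => //; exists (X i j).
have o3 i j k l : '[iota (Z \o X i j), iota (X k l \o Z)] = 0.
  by apply: orthZXXZ; [exists (X i j) | exists (X k l)].
have s0 : '[iota Z, iota Z] != 0.
  apply/eqP => s0; apply: Zn0; apply: (iota_inj ft iL) => //.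
  by apply: dot_def; rewrite s0.
(* Coordinate i of Z Q = Q Z Q, evaluated at [Om] placed in slot j. *)
have ZQ j i : iota (Z \o x i j) = \sum_k iota (x i k \o (Z \o x k j)).
  have WZ : W (fun i => lambda Z (Q (inj j Om) i)).
    by apply: Wstable; [left; left | exact: WQ].
  have := congr1 (@^~ i) (fQ _ WZ); rewrite QE -/(q i j Om) (xP i j).2.
  rewrite (lam_Om vM iL) // (L2_left_mul iL) // => <-; apply: eq_bigr => k _.
  rewrite -/(q k j Om) (xP k j).2 (xP i k).2 (lam_Om vM iL) // !(L2_left_mul iL) //.
  exact: vn_comp.
(* Pairing [ZQ] with [iota Z] and moving x_ik across as x_ki gives <Z x_kj, x_ki Z>, of which only
   t_kj conj(t_ki) |Z|^2 survives. *)
have tt i j : t i j = \sum_k t k j * ((t k i)^* )%R.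
  apply: (mulIf s0); rewrite mulr_suml.
  have <- : '[iota (Z \o x i j), iota Z] = t i j * '[iota Z, iota Z].
    by rewrite ZxE dot_linear o1' addr0.
  have -> : '[iota (Z \o x i j), iota Z] =
      \sum_k '[iota (x i k \o (Z \o x k j)), iota Z].
    rewrite ZQ; apply: (big_ind2 (fun (u : L) z => '[u, iota Z] = z)) => //.
      exact: dot0l.
    by move=> u _ v _ <- <-; rewrite dotDl.
  apply: eq_bigr => k _; have MZx := vn_comp vM MZ (Mx k j).
  rewrite -(L2_left_mul iL) // (adjP (lam_blin iL (Mx i k))) (lam_adj vM iL) // xadj.
  rewrite (L2_left_mul iL) // ZxE xZE.
  by rewrite dot_linear !dotDr !dotZr o3 o1' o2 mulr0 !addr0 mulrA.
(* Column j: the sum of |x_ij|^2 is |Q e_j|^2 = <Q e_j, e_j> = t_jj for e_j = [inj j Om], while [tt]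
   on the diagonal says that the sum of |t_ij|^2 is t_jj too. *)
have X0 k j : iota (X k j) = 0.
  have norm i : '[iota (X i j), iota (X i j)] =
      '[iota (x i j), iota (x i j)] - t i j * ((t i j)^* )%R.
    have tE : '[iota (x i j), Om] = t i j.
      by rewrite (L2_dot iL) // adj_id.
    have OmE : '[Om, Om] = 1 by rewrite (L2_dot iL) // adj_id (trace_unit ft).
    rewrite (iotaB iL) // (iotaZ vM iL) //.
    rewrite dotBl !dotBr !dotZl !dotZr tE OmE (dotC (iota (x i j)) Om) tE.
    by ring.
  have sum0 : \sum_i '[iota (X i j), iota (X i j)] = 0.
    rewrite (eq_bigr _ (fun i _ => norm i)) sumrB -tt.
    have -> : \sum_i '[iota (x i j), iota (x i j)] = dsum (Q (inj j Om)) (Q (inj j Om)).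
      by apply: eq_bigr => i _; rewrite -/(q i j Om) (xP i j).2 (lam_Om vM iL).
    rewrite sQ (fQ _ (WQ _)) -sQ.
    by rewrite dsum_inj -/(q j j Om) (xP j j).2 (lam_Om vM iL) // (L2_dot iL) // adj_id subrr.
  have Xj_ge0 i : true -> 0 <= '[iota (X i j), iota (X i j)] by move=> _; exact: dot_ge0.
  have Xkj : '[iota (X k j), iota (X k j)] = 0 by exact: (psumr_eq0P Xj_ge0 sum0).
  by apply: dot_def; rewrite Xkj.
have qE i j u : q i j u = t i j *: u.
  rewrite (xP i j).2; have /eqP := iota_inj ft iL (MX i j) (X0 i j).
  rewrite subr_eq0 => /eqP ->.
  by rewrite (lamZ vM iL) // (lam_id vM iL).
have Qt v i : Q v i = \sum_j t i j *: v j.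
  by rewrite QE; apply: eq_bigr => j _; rewrite qE.
exists t; split=> [w Ww i|w hw]; first by rewrite -Qt fQ.
have -> : w = Q w by apply/funext => i; rewrite Qt.
exact: WQ.
Qed.

End Amplification.

Lemma approximation (I : finType) (T : L -> L) (x : I -> L) (e : R) :
  linear T -> 0 < e -> exists2 S, A S & forall i, nm (T (x i) - S (x i)) < e.
Proof.
move=> lT; move: e.
pose W : set (I -> L) := [set w | forall e : R, 0 < e ->
  exists2 S, A S & forall i, nm (w i - S (x i)) < e].
suff : W (fun i => T (x i)) by move=> h e; exact: h.
have [sub1 sub2 sub3 sub4 sub5] := A_subalgebra.
have AW S : A S -> W (fun i => S (x i)).
  by move=> AS e e0; exists S => // i; rewrite subrr nm0.
have [||| T' w gT Ww|t [h1 h2]] := @invariant_scalar I W.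
- move=> a u v hu hv e e0.
  have a0 : 0 <= Re `|a| by have := normr_ge0 a; rewrite lecE => /andP[].
  have e1 : 0 < e / (Re `|a| + 1) by rewrite divr_gt0 // ltr_wpDl.
  have [S AS hS] := hu _ e1; have [S' AS' hS'] := hv _ e1.
  exists (a *: S + S') => [|i]; first by apply: sub3 => //; exact: sub4.
  rewrite ?fctE opprD addrACA -scalerBr; apply: le_lt_trans (nmD _ _) _; rewrite nmZ.
  have h : Re `|a| * nm (u i - S (x i)) <= Re `|a| * (e / (Re `|a| + 1)).
    by rewrite ler_wpM2l // ltW.
  have -> : e = Re `|a| * (e / (Re `|a| + 1)) + e / (Re `|a| + 1).
    by field; apply: lt0r_neq0; rewrite ltr_wpDl.
  by have := hS' i; lra.
- by have := AW _ sub2.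
- move=> w hw e e0; have e2 : 0 < e / 2 by lra.
  have [w' Ww' h1] := hw _ e2; have [S AS h2] := Ww' _ e2.
  exists S => // i; rewrite -[_ - _](subrKA (w' i)); apply: le_lt_trans (nmD _ _) _.
  by have := h1 i; have := h2 i; lra.
- move=> e e0; have AT := A_gens gT; have bT := A_blin AT.
  have [C C0 hC] := blin_bound bT.
  have [|S AS hS] := Ww (e / C); first by rewrite divr_gt0.
  exists (T' \o S) => [|i]; first exact: sub5.
  rewrite /= -(linB _ _ (blin_lin bT)); apply: le_lt_trans (hC _) _.
  by rewrite mulrC -ltr_pdivlMr.
(* The identity lies in the algebra, so the family [x] itself belongs to [W]; [T] carries its
   defining relations over to the family T x_i. *)
apply: h2 => i; have xE : x i = \sum_j t i j *: x j := h1 _ (AW _ A_id) i.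
rewrite {1}xE.
apply: (big_ind2 (fun u v => T u = v)) => //; first exact: lin0.
  by move=> u _ v _ <- <-; exact: linD.
by move=> j _; exact: linZ.
Qed.

(** The closure is reached through a filter on the algebra, whose basic sets approximate [T] on a
    finite list of vectors up to a tolerance. Approximation makes it proper, and it converges to [T]
    pointwise. *)
Lemma A_dense : strongly_dense A.
Proof.
move=> T bT; rewrite bounded_opE in bT.
pose B (p : seq L * R) := [set S | A S /\ forall y, y \in p.1 -> nm (T y - S y) < p.2].
pose D := [set p : seq L * R | 0 < p.2].
have FF : Filter (filter_from D B).
  apply: filter_from_filter; first by exists ([::], 1) => /=; exact: ltr01.
  move=> [s e] [s' e'] /= e0 e0'; exists (s ++ s', Num.min e e') => /=.
    by rewrite /D /= lt_min e0.
  move=> S [AS hS] /=; split; split=> //= y ys.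
    by apply: lt_le_trans (hS y _) _; rewrite /= ?mem_cat ?ys // ge_min lexx.
  by apply: lt_le_trans (hS y _) _; rewrite /= ?mem_cat ?ys ?orbT // ge_min lexx orbT.
have PF : ProperFilter (filter_from D B).
  apply: filter_from_proper => -[s e] /= e0.
  have [S AS hS] := @approximation 'I_(size s) T (fun i => nth 0 s i) e (blin_lin bT) e0.
  exists S; split=> //= y ys; move: (ys); rewrite -index_mem => ys'.
  by have := hS (Ordinal ys'); rewrite /= nth_index.
rewrite closureEcvg; exists (filter_from D B) => //; split.
  apply/pointwise_cvgP => y; apply/cvgrPdist_lt => e e0.
  have eE : e = (Re e)%:C by apply: ge0_complex; exact: ltW.
  exists ([:: y], Re e) => [|S [_ /(_ y)]]; first by rewrite /D /= -ltcR -eE.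
  by rewrite /= inE eqxx nmE eE ltcR; exact.
move=> P PA; exists ([::], 1) => [|S [AS _]]; first by rewrite /D /= ltr01.
exact: PA.
Qed.

Lemma A_transitive : transitive_algebra A.
Proof.
split; [exact: A_subalgebra | exact: A_id|].
move=> W cW Winv; have [W0 WD WZ Wc] := cW.
have [[w Ww w0]|none] := pselect (exists2 w, W w & w <> 0); last first.
  left; apply/seteqP; split=> [x Wx /=|x ->//].
  by apply: contrapT => x0; apply: none; exists x.
right; apply/seteqP; split=> // v _; apply: closed_nm Wc _ => e e0.
(* Rank-one operator with T w = v; approximating it at the single vector [w] places [v] in the
   closed subspace [W]. *)
pose T (u : L) := ('[u, w] / '[w, w]) *: v.
have lT : linear T.
  by move=> a x y; rewrite /T dot_linear mulrDl scalerDl scalerA mulrA.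
have ww : '[w, w] != 0 by apply/eqP => h; apply: w0; apply: dot_def; rewrite h.
have [S AS hS] := @approximation 'I_1 T (fun _ => w) e lT e0.
exists (S w); first by apply: (Winv S AS); exists w.
by have := hS ord0; rewrite /T divff // scale1r.
Qed.

End Transitive.

Theorem theorem4p1 (R : realType) (H : hilbertType R)
    (M : set (H -> H)) (tau : (H -> H) -> R[i])
    (L : hilbertType R) (iota : (H -> H) -> L) (lambda : (H -> H) -> (L -> L))
    (N : set (H -> H)) (Z : H -> H) :
  von_neumann_algebra M -> finite_algebra M ->
  faithful_normal_trace M tau ->
  is_L2 M tau iota lambda ->
  von_neumann_algebra N -> N `<=` M ->
  M Z ->
  Z <> 0 -> tau Z = 0 ->
  let K := [set X | (commutant N `&` M) X /\ tau X = 0] in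
  orthogonal_sets [set iota Z] [set iota (Z \o X) | X in K] ->
  orthogonal_sets [set iota Z] [set iota (X \o Z) | X in K] ->
  orthogonal_sets [set iota (Z \o X) | X in K] [set iota (X \o Z) | X in K] ->
  let A := generated_algebra
    ([set lambda Z] `|` lambda @` N `|` commutant (lambda @` M)) in
  transitive_algebra A /\ strongly_dense A.
Proof.
move=> vM _ ft iL vN NM MZ Zn0 _ K o1 o2 o3 A; split.
- exact: (A_transitive vM ft iL vN NM MZ Zn0 o1 o2 o3).
- exact: (A_dense vM ft iL vN NM MZ Zn0 o1 o2 o3).
Qed.
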